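(* Let $H\in\mathcal A$ depend only on the action $A$, let $\mathcal H=1-\mathrm e^{-\{H\}}$, let $\Gamma:\mathcal A\to\mathcal A$ be a linear pseudo-inverse of $\mathcal H$, i.e. $\mathcal H^2\Gamma=\mathcal H$, and put $\mathcal N=\mathcal H\Gamma$, $\mathcal R=1-\mathcal N$. Let $V\in\mathcal A$. Then there exists a control term $f$ of order $V^2$ such that the map generated by $H\boxplus V\boxplus f$ is canonically conjugate to the map generated by $H\boxplus\mathcal R V$. The control term is given by $$f=(-V)\boxplus(\mathcal N V-\Gamma V)\boxplus\mathcal R V\boxplus\Gamma V,$$ and the conjugation is generated by $\Gamma V$. Explicitly, with this $f$, $$\mathrm e^{\{\Gamma V\}}\,\mathrm e^{\{H\}}\mathrm e^{\{V\}}\mathrm e^{\{f\}}\,\mathrm e^{-\{\Gamma V\}}=\mathrm e^{\{H\}}\mathrm e^{\{\mathcal R V\}}.$$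
   Context: $\mathcal A$ is the vector space of $C^\infty$ real functions on the phase space $\mathbb R\times\mathbb T$ with coordinates $(A,\varphi)$, $\mathbb T=\mathbb R/2\pi\mathbb Z$. For $H\in\mathcal A$, $\{H\}$ denotes the linear operator on $\mathcal A$ given by the Poisson bracket, $$\{H\}=\frac{\partial H}{\partial A}\frac{\partial}{\partial\varphi}-\frac{\partial H}{\partial\varphi}\frac{\partial}{\partial A},\qquad \{H\}H'=\{H,H'\},$$ and $\mathrm e^{\{H\}}=\sum_{n\ge0}\{H\}^n/n!$. When $H$ depends only on $A$, with $\omega(A)=\partial_AH$, $\mathrm e^{\{H\}}$ acts by $(\mathrm e^{\{H\}}U)(A,\varphi)=U(A,\varphi+\omega(A))$. The warped addition $\boxplus$ on $\mathcal A$ is defined by $\mathrm e^{\{U\boxplus W\}}=\mathrm e^{\{U\}}\mathrm e^{\{W\}}$; it is associative, and $U\boxplus W$ is given by the Baker-Campbell-Hausdorff series $U\boxplus W=U+W+\frac12\{U\}W+\cdots$. The map generated by $H\boxplus V$ (resp. $H\boxplus V\boxplus f$) is the transformation $(A,\varphi)\mapsto(A',\varphi')$ obtained by applying $\mathrm e^{\{H\}}\mathrm e^{\{V\}}$ (resp. $\mathrm e^{\{H\}}\mathrm e^{\{V\}}\mathrm e^{\{f\}}$) to the coordinate functions $A$ and $\varphi$. That the conjugation is generated by $\Gamma V$ means that it is implemented by conjugating operators with $\mathrm e^{\{\Gamma V\}}$. All statements are understood formally in $V$: replace $V$ by $\varepsilon V$ and work with formal power series in $\varepsilon$ with coefficients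 in $\mathcal A$ (respectively, in linear operators on $\mathcal A$). ''$f$ is of order $V^2$'' means that the resulting series $f$ has no terms of degree $0$ or $1$ in $\varepsilon$. A pseudo-inverse $\Gamma$ is assumed to exist. Formally, for $H=H(A)$ and $U=\sum_kU_k(A)\mathrm e^{ik\varphi}$, one may take $\Gamma U=\sum_{k:\,k\omega(A)\notin2\pi\mathbb Z}\frac{U_k(A)}{1-\mathrm e^{-ik\omega(A)}}\mathrm e^{ik\varphi}$, in which case $\mathcal RU=\sum_{k:\,k\omega(A)\in2\pi\mathbb Z}U_k(A)\mathrm e^{ik\varphi}$ and $\mathcal N U=\sum_{k:\,k\omega(A)\notin2\pi\mathbb Z}U_k(A)\mathrm e^{ik\varphi}$. *)

(* Defs.v *)
From Stdlib Require Import Reals Factorial List Bool.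
From Coquelicot Require Import Coquelicot.
Import ListNotations.
Open Scope R_scope.

(** A function on R x T is represented by its lift to R x R, which is
    2 pi-periodic in the second variable.  The operators below are total on
    [R -> R -> R]; in this way they also act on the angle coordinate, which is
    not periodic. *)
Definition fn := R -> R -> R.

Definition fzero : fn := fun _ _ => 0.
Definition fadd (U W : fn) : fn := fun A phi => U A phi + W A phi.
Definition fopp (U : fn) : fn := fun A phi => - U A phi.
Definition fsub (U W : fn) : fn := fun A phi => U A phi - W A phi.
Definition fscal (a : R) (U : fn) : fn := fun A phi => a * U A phi.

Definition phase_function (U : fn) : Prop :=
  (forall n A phi, ex_diff_n U n A phi) /\
  (forall A phi, U A (phi + 2 * PI) = U A phi).

Definition dA (U : fn) : fn := fun A phi => Derive (fun a => U a phi) A.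
Definition dphi (U : fn) : fn := fun A phi => Derive (fun p => U A p) phi.

Definition poisson (U W : fn) : fn :=
  fun A phi => dA U A phi * dphi W A phi - dphi U A phi * dA W A phi.

Definition action_only (H : fn) : Prop :=
  forall A phi psi, H A phi = H A psi.

(** The operator e^{H} for H depending only on A: the shift of phi by
    omega(A), where omega = dA H. *)
Definition exp_action (H U : fn) : fn :=
  fun A phi => U A (phi + dA H A phi).

(** The operator 1 - e^{-{H}}, where -{H} = {-H}. *)
Definition calH (H U : fn) : fn := fsub U (exp_action (fopp H) U).

Definition linear_on_phase_functions (Gamma : fn -> fn) : Prop :=
  (forall U, phase_function U -> phase_function (Gamma U)) /\
  (forall a U W, phase_function U -> phase_function W ->
     Gamma (fadd (fscal a U) W) = fadd (fscal a (Gamma U)) (Gamma W)).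

Definition pseudo_inverse (H : fn) (Gamma : fn -> fn) : Prop :=
  forall U, phase_function U -> calH H (calH H (Gamma U)) = calH H U.

Definition calN (H : fn) (Gamma : fn -> fn) (U : fn) : fn := calH H (Gamma U).
Definition calR (H : fn) (Gamma : fn -> fn) (U : fn) : fn :=
  fsub U (calN H Gamma U).

Definition series := nat -> fn.

Definition szero : series := fun _ => fzero.
Definition sadd (U W : series) : series := fun m => fadd (U m) (W m).
Definition sopp (U : series) : series := fun m => fopp (U m).
Definition ssub (U W : series) : series := fun m => fsub (U m) (W m).

(** The monomial epsilon^k U. *)
Definition monomial (k : nat) (U : fn) : series :=
  fun m => if Nat.eqb m k then U else fzero.

Definition phase_series (U : series) : Prop := forall m, phase_function (U m).

Definition of_order (k : nat) (U : series) : Prop :=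
  forall m, (m < k)%nat -> U m = fzero.

Definition spoisson (U W : series) : series :=
  fun m A phi => sum_n (fun i => poisson (U i) (W (m - i)%nat) A phi) m.

(** The operator e^{U} = sum_k {U}^k / k! for U without term of degree 0.  For
    such U, {U}^k raises the degree by at least k, so that only k <= m
    contributes in degree m. *)
Definition exp_series (U G : series) : series :=
  fun m A phi =>
    sum_n (fun k => Nat.iter k (spoisson U) G m A phi / INR (fact k)) m.

Definition exp_action_series (H : fn) (G : series) : series :=
  fun m => exp_action H (G m).

(** Noncommutative power series in two letters x = [true] and y = [false],
    given by the coefficient of each word. *)
Definition word := list bool.
Definition ncseries := word -> R.

Definition nc_one : ncseries := fun w => match w with [] => 1 | _ => 0 end.

Definition nc_mul (p q : ncseries) : ncseries :=
  fun w => sum_n (fun i => p (firstn i w) * q (skipn i w)) (length w).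

Definition nc_exp_letter (b : bool) : ncseries :=
  fun w => if forallb (Bool.eqb b) w then / INR (fact (length w)) else 0.

(** log g = sum_{k>=1} (-1)^(k-1) (g - 1)^k / k for g with constant term 1;
    (g - 1)^k vanishes on words of length less than k. *)
Definition nc_log (g : ncseries) : ncseries :=
  fun w =>
    sum_n_m (fun k => (-1) ^ (k - 1) / INR k
                      * Nat.iter k (nc_mul (fun v => g v - nc_one v)) nc_one w)
            1 (length w).

Definition bch_coeff : ncseries :=
  nc_log (nc_mul (nc_exp_letter true) (nc_exp_letter false)).

Fixpoint words (n : nat) : list word :=
  match n with
  | O => [[]]
  | S n' => map (cons true) (words n') ++ map (cons false) (words n')
  end.

(** The right-nested bracket {X_1, {X_2, ... {X_(n-1), X_n}}} of a word. *)
Fixpoint nested_bracket (U W : series) (w : word) : series :=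
  match w with
  | [] => szero
  | [b] => if b then U else W
  | b :: w' => spoisson (if b then U else W) (nested_bracket U W w')
  end.

(** Warped addition, as the Baker-Campbell-Hausdorff series in Dynkin's form:
    the sum over nonempty words w of c_w / |w| times the nested bracket of w,
    where c_w is the coefficient of w in log (e^x e^y).  It is meant for U and
    W without term of degree 0; then only words of length at most m contribute
    in degree m. *)
Definition boxplus (U W : series) : series :=
  fun m A phi =>
    sum_n_m (fun n =>
      fold_right Rplus 0
        (map (fun w => bch_coeff w / INR n * nested_bracket U W w m A phi)
             (words n)))
      1 m.

Notation "U ⊞ W" := (boxplus U W) (at level 50, left associativity).

Definition coord_A : fn := fun A _ => A.
Definition coord_phi : fn := fun _ phi => phi.

(** The formal transformation (A, phi) |-> (A', phi') obtained by applying an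
    operator to the coordinate functions. *)
Definition generated_map (P : series -> series) : series * series :=
  (P (monomial 0 coord_A), P (monomial 0 coord_phi)).

Definition conj_exp (W : series) (P : series -> series) : series -> series :=
  fun G => exp_series W (P (exp_series (sopp W) G)).

(** The map generated by P is carried to the map generated by Q by the formal
    canonical transformation generated by W, i.e. by conjugating operators
    with e^{W}. *)
Definition conjugate_via (W : series) (P Q : series -> series) : Prop :=
  (phase_series W /\ of_order 1 W) /\
  (forall G, phase_series G -> conj_exp W P G = Q G) /\
  generated_map (conj_exp W P) = generated_map Q.

(* Main.v *)
(** The term [V] cancels against [-V], so [e^{V} e^{f}] equals
    [e^{NV - Gamma V} e^{RV} e^{Gamma V}] once the Baker-Campbell-Hausdorff
    theorem [e^{U ⊞ W} = e^{U} e^{W}] is known.  As [e^{H}] is a Poisson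
    automorphism and [NV - Gamma V = - e^{-{H}} Gamma V], moving [e^{H}] to the
    right of [e^{NV - Gamma V}] turns the latter into [e^{-Gamma V}], which
    cancels the leading [e^{Gamma V}].

    For the Baker-Campbell-Hausdorff theorem in Dynkin's form, let
    [L = log (e^x e^y)] in noncommutative power series and let [deg] be the
    derivation multiplying a word by its length.  Applying [deg] to
    [e^L = e^x e^y] gives
      [sum_k ad_L^k (deg L) / (k+1)! = x + e^{ad_x} y],
    which expresses each homogeneous part of [L] through commutators of parts of
    lower degree.  By induction every homogeneous part [L_n] belongs to the class
    of those [p] of degree [n] for which [n] times the evaluation of [p] at the
    operators [{U}], [{W}] is the bracket with the right-nested bracketing of
    [p]; this class is closed under commutators by the Jacobi identity. *)
From HB Require Import structures.
From Stdlib Require Import Reals List FunctionalExtensionality.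
From Coquelicot Require Import Coquelicot.
Require Import Defs.
Open Scope R_scope.

(** * Smooth functions on the phase space *)

(** Periodicity is left out, so that the class contains the angle coordinate. *)
Definition smooth (U : fn) : Prop := forall n A phi, ex_diff_n U n A phi.

(** One layer of the recursion of [ex_diff_n]; continuity of the partial derivatives themselves
    belongs to the next layer. *)
Definition C1_at (U : fn) (A phi : R) : Prop :=
  continuity_2d_pt U A phi /\ ex_derive (fun a => U a phi) A /\ ex_derive (fun p => U A p) phi.

Lemma smooth_C1 U A phi : smooth U -> C1_at U A phi.
Proof.
  intros HU. destruct (HU 1%nat A phi) as [H0 [H1 [H2 _]]]. repeat split; assumption.
Qed.

Lemma smooth_dA U : smooth U -> smooth (dA U).
Proof. intros HU n A phi. apply (HU (S n) A phi). Qed.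

Lemma smooth_dphi U : smooth U -> smooth (dphi U).
Proof. intros HU n A phi. apply (HU (S n) A phi). Qed.

(** The induction on the order of differentiability happens once, here; afterwards smoothness is
    shown by exhibiting a class stable under both partial derivatives. *)
Lemma smooth_coinduction (P : fn -> Prop) :
  (forall U, P U -> (forall A phi, C1_at U A phi) /\ P (dA U) /\ P (dphi U)) ->
  forall U, P U -> smooth U.
Proof.
  intros HP U HU n. revert U HU.
  induction n as [|n IH]; intros U HU A phi; destruct (HP U HU) as [HC [H1 H2]].
  - split; [apply HC | exact I].
  - destruct (HC A phi) as [C0 [C1 C2]].
    split; [exact C0 | split; [exact C1 | split; [exact C2 | split]]].
    + apply (IH _ H1).
    + apply (IH _ H2).
Qed.

Lemma fn_ext (U W : fn) : (forall A phi, U A phi = W A phi) -> U = W.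
Proof.
  intros E. apply functional_extensionality; intros A.
  apply functional_extensionality; intros phi. apply E.
Qed.

Definition fconst (c : R) : fn := fun _ _ => c.
Definition fmul (U W : fn) : fn := fun A phi => U A phi * W A phi.

Lemma dA_const c : dA (fconst c) = fconst 0.
Proof. apply fn_ext; intros A phi. exact (Derive_const c A). Qed.

Lemma dphi_const c : dphi (fconst c) = fconst 0.
Proof. apply fn_ext; intros A phi. exact (Derive_const c phi). Qed.

Lemma smooth_const c : smooth (fconst c).
Proof.
  apply (smooth_coinduction (fun U => exists c, U = fconst c)); [|now exists c].
  intros U [d ->]. split; [|split].
  - intros A phi. split; [|split].
    + apply continuity_2d_pt_const.
    + exact (ex_derive_const d A).
    + exact (ex_derive_const d phi).
  - exists 0. apply dA_const.
  - exists 0. apply dphi_const.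
Qed.

(** Total differentiability, which the chain rule needs when [A] moves both arguments of a shifted
    function. It follows from the existence of both partial derivatives and the continuity of
    one. *)
Lemma smooth_differentiable U A phi :
  smooth U -> differentiable_pt_lim U A phi (dA U A phi) (dphi U A phi).
Proof.
  intros HU. apply filterdiff_differentiable_pt_lim.
  apply (is_derive_filterdiff U A phi (dA U) (dphi U A phi)).
  - apply filter_forall. intros [a p]. apply Derive_correct.
    apply (smooth_C1 U a p HU).
  - apply Derive_correct. apply (smooth_C1 U A phi HU).
  - apply continuity_2d_pt_filterlim. apply (smooth_C1 (dA U) A phi). now apply smooth_dA.
Qed.

Lemma shift_derive_A H U A phi : smooth H -> smooth U ->
  is_derive (fun a => exp_action H U a phi) A
    (exp_action H (dA U) A phi + exp_action H (dphi U) A phi * dA (dA H) A phi).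
Proof.
  intros HH HU. apply is_derive_Reals.
  replace (exp_action H (dA U) A phi) with (exp_action H (dA U) A phi * 1) by ring.
  apply (derivable_pt_lim_comp_2d U (fun a => a) (fun a => phi + dA H a phi)).
  - now apply smooth_differentiable.
  - apply derivable_pt_lim_id.
  - apply is_derive_Reals.
    replace (dA (dA H) A phi) with (plus zero (dA (dA H) A phi)) by (unfold plus, zero; simpl; ring).
    apply (is_derive_plus (fun _ => phi) (fun a => dA H a phi)).
    + apply (is_derive_const phi A).
    + apply Derive_correct. apply (smooth_C1 (dA H) A phi). now apply smooth_dA.
Qed.

Lemma shift_derive_phi H U A phi : smooth H -> smooth U ->
  is_derive (fun p => exp_action H U A p) phi
    (exp_action H (dphi U) A phi * (1 + dphi (dA H) A phi)).
Proof.
  intros HH HU. unfold exp_action. rewrite Rmult_comm.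
  apply (is_derive_comp (fun p => U A p) (fun p => p + dA H A p)).
  - apply Derive_correct. apply (smooth_C1 U A _ HU).
  - apply (is_derive_plus (fun p => p) (fun p => dA H A p)).
    + apply (is_derive_id phi).
    + apply Derive_correct. apply (smooth_C1 (dA H) A phi). now apply smooth_dA.
Qed.

Lemma dA_add U W A phi : C1_at U A phi -> C1_at W A phi ->
  dA (fadd U W) A phi = dA U A phi + dA W A phi.
Proof. intros HU HW. apply (Derive_plus (fun a => U a phi) (fun a => W a phi)); [apply HU | apply HW]. Qed.

Lemma dphi_add U W A phi : C1_at U A phi -> C1_at W A phi ->
  dphi (fadd U W) A phi = dphi U A phi + dphi W A phi.
Proof. intros HU HW. apply (Derive_plus (fun p => U A p) (fun p => W A p)); [apply HU | apply HW]. Qed.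

Lemma dA_mul U W A phi : C1_at U A phi -> C1_at W A phi ->
  dA (fmul U W) A phi = dA U A phi * W A phi + U A phi * dA W A phi.
Proof. intros HU HW. apply (Derive_mult (fun a => U a phi) (fun a => W a phi)); [apply HU | apply HW]. Qed.

Lemma dphi_mul U W A phi : C1_at U A phi -> C1_at W A phi ->
  dphi (fmul U W) A phi = dphi U A phi * W A phi + U A phi * dphi W A phi.
Proof. intros HU HW. apply (Derive_mult (fun p => U A p) (fun p => W A p)); [apply HU | apply HW]. Qed.

(** Smoothness of sums, products and shifts is proved by coinduction on this
    class, which is closed under both partial derivatives. *)
Inductive generated (H : fn) : fn -> Prop :=
| generated_smooth U : smooth U -> generated H U
| generated_shift U : smooth U -> generated H (exp_action H U)
| generated_add U W : generated H U -> generated H W -> generated H (fadd U W)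
| generated_mul U W : generated H U -> generated H W -> generated H (fmul U W).

Lemma generated_C1 H U : smooth H -> generated H U -> forall A phi, C1_at U A phi.
Proof.
  intros HH HU. induction HU as [U HU|U HU|U W _ IHU _ IHW|U W _ IHU _ IHW]; intros A phi.
  - now apply smooth_C1.
  - split; [|split].
    + intros eps.
      destruct (proj1 (smooth_C1 U A (phi + dA H A phi) HU) eps) as [d1 H1].
      assert (Cg : continuity_2d_pt (fun a p => p + dA H a p) A phi).
      { apply continuity_2d_pt_plus; [apply continuity_2d_pt_id2|].
        apply (smooth_C1 (dA H)). now apply smooth_dA. }
      destruct (Cg d1) as [d2 H2].
      exists (mkposreal _ (Rmin_stable_in_posreal d1 d2)). simpl. intros a p Ha Hp.
      apply H1; [|apply H2]; eapply Rlt_le_trans;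
        eassumption || apply Rmin_l || apply Rmin_r.
    + eexists. now apply shift_derive_A.
    + eexists. now apply shift_derive_phi.
  - destruct (IHU A phi) as [U0 [U1 U2]], (IHW A phi) as [W0 [W1 W2]]. split; [|split].
    + now apply continuity_2d_pt_plus.
    + now apply (ex_derive_plus (fun a => U a phi) (fun a => W a phi)).
    + now apply (ex_derive_plus (fun p => U A p) (fun p => W A p)).
  - destruct (IHU A phi) as [U0 [U1 U2]], (IHW A phi) as [W0 [W1 W2]]. split; [|split].
    + now apply continuity_2d_pt_mult.
    + now apply (ex_derive_mult (fun a => U a phi) (fun a => W a phi)).
    + now apply (ex_derive_mult (fun p => U A p) (fun p => W A p)).
Qed.

(** Differentiating a shift brings out second derivatives of [H] as factors, hence the products in
    the class. *)
Lemma generated_is_smooth H U : smooth H -> generated H U -> smooth U.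
Proof.
  intros HH HU. apply (smooth_coinduction (generated H)); [|exact HU]. clear U HU.
  intros U HU. split; [now apply (generated_C1 H)|].
  induction HU as [U HU|U HU|U W HU IHU HW IHW|U W HU IHU HW IHW].
  - split; apply generated_smooth; [now apply smooth_dA | now apply smooth_dphi].
  - split.
    + replace (dA (exp_action H U)) with
        (fadd (exp_action H (dA U)) (fmul (exp_action H (dphi U)) (dA (dA H)))).
      * apply generated_add; [|apply generated_mul].
        -- apply generated_shift. now apply smooth_dA.
        -- apply generated_shift. now apply smooth_dphi.
        -- apply generated_smooth. now apply smooth_dA, smooth_dA.
      * apply fn_ext; intros A phi. symmetry. apply is_derive_unique. now apply shift_derive_A.
    + replace (dphi (exp_action H U)) with
        (fmul (exp_action H (dphi U)) (fadd (fconst 1) (dphi (dA H)))).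
      * apply generated_mul; [|apply generated_add].
        -- apply generated_shift. now apply smooth_dphi.
        -- apply generated_smooth, smooth_const.
        -- apply generated_smooth. now apply smooth_dphi, smooth_dA.
      * apply fn_ext; intros A phi. symmetry. apply is_derive_unique. now apply shift_derive_phi.
  - assert (CU := generated_C1 H U HH HU). assert (CW := generated_C1 H W HH HW). split.
    + replace (dA (fadd U W)) with (fadd (dA U) (dA W)); [now apply generated_add|].
      apply fn_ext; intros A phi. symmetry. now apply dA_add.
    + replace (dphi (fadd U W)) with (fadd (dphi U) (dphi W)); [now apply generated_add|].
      apply fn_ext; intros A phi. symmetry. now apply dphi_add.
  - assert (CU := generated_C1 H U HH HU). assert (CW := generated_C1 H W HH HW). split.
    + replace (dA (fmul U W)) with (fadd (fmul (dA U) W) (fmul U (dA W))).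
      * apply generated_add; now apply generated_mul.
      * apply fn_ext; intros A phi. symmetry. now apply dA_mul.
    + replace (dphi (fmul U W)) with (fadd (fmul (dphi U) W) (fmul U (dphi W))).
      * apply generated_add; now apply generated_mul.
      * apply fn_ext; intros A phi. symmetry. now apply dphi_mul.
Qed.

Lemma smooth_add U W : smooth U -> smooth W -> smooth (fadd U W).
Proof.
  (* The parameter of [generated] enters only through shifts; for sums a constant serves. *)
  intros HU HW. apply (generated_is_smooth (fconst 0)); [apply smooth_const|].
  apply generated_add; now apply generated_smooth.
Qed.

Lemma smooth_mul U W : smooth U -> smooth W -> smooth (fmul U W).
Proof.
  intros HU HW. apply (generated_is_smooth (fconst 0)); [apply smooth_const|].
  apply generated_mul; now apply generated_smooth.
Qed.

Lemma smooth_scal c U : smooth U -> smooth (fscal c U).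
Proof. intros HU. apply (smooth_mul (fconst c) U); [apply smooth_const | exact HU]. Qed.

Lemma smooth_opp U : smooth U -> smooth (fopp U).
Proof.
  intros HU. replace (fopp U) with (fscal (-1) U); [now apply smooth_scal|].
  apply fn_ext; intros A phi. unfold fscal, fopp. ring.
Qed.

Lemma smooth_sub U W : smooth U -> smooth W -> smooth (fsub U W).
Proof.
  intros HU HW. apply (smooth_add U (fopp W)); [exact HU | now apply smooth_opp].
Qed.

Lemma smooth_exp_action H U : smooth H -> smooth U -> smooth (exp_action H U).
Proof.
  intros HH HU. apply (generated_is_smooth H); [exact HH | now apply generated_shift].
Qed.

Lemma smooth_poisson U W : smooth U -> smooth W -> smooth (poisson U W).
Proof.
  intros HU HW.
  apply (smooth_sub (fmul (dA U) (dphi W)) (fmul (dphi U) (dA W))); apply smooth_mul;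
    (now apply smooth_dA) || (now apply smooth_dphi).
Qed.

Lemma smooth_coord_A : smooth coord_A.
Proof.
  (* Both partial derivatives of the coordinate are constants, so adjoining it to the smooth
     functions gives a stable class. *)
  apply (smooth_coinduction (fun U => U = coord_A \/ smooth U)); [|now left].
  intros U [->|HU].
  - split; [|split].
    + intros A phi. split; [apply continuity_2d_pt_id1 | split].
      * apply (ex_derive_id A).
      * exact (ex_derive_const A phi).
    + right. replace (dA coord_A) with (fconst 1); [apply smooth_const|].
      apply fn_ext; intros A phi. symmetry. apply Derive_id.
    + right. replace (dphi coord_A) with (fconst 0); [apply smooth_const|].
      apply fn_ext; intros A phi. symmetry. exact (Derive_const A phi).
  - split; [intros A phi; now apply smooth_C1 | split; right].
    + now apply smooth_dA.
    + now apply smooth_dphi.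
Qed.

Lemma smooth_coord_phi : smooth coord_phi.
Proof.
  apply (smooth_coinduction (fun U => U = coord_phi \/ smooth U)); [|now left].
  intros U [->|HU].
  - split; [|split].
    + intros A phi. split; [apply continuity_2d_pt_id2 | split].
      * exact (ex_derive_const phi A).
      * apply (ex_derive_id phi).
    + right. replace (dA coord_phi) with (fconst 0); [apply smooth_const|].
      apply fn_ext; intros A phi. symmetry. exact (Derive_const phi A).
    + right. replace (dphi coord_phi) with (fconst 1); [apply smooth_const|].
      apply fn_ext; intros A phi. symmetry. apply Derive_id.
  - split; [intros A phi; now apply smooth_C1 | split; right].
    + now apply smooth_dA.
    + now apply smooth_dphi.
Qed.

Lemma smooth_schwarz U A phi : smooth U -> dA (dphi U) A phi = dphi (dA U) A phi.
Proof.
  intros HU. apply (Schwarz U A phi).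
  - apply locally_2d_forall. intros a p. split; [|split; [|split]].
    + apply (smooth_C1 U a p HU).
    + apply (smooth_C1 U a p HU).
    + apply (smooth_C1 (dphi U) a p). now apply smooth_dphi.
    + apply (smooth_C1 (dA U) a p). now apply smooth_dA.
  - apply (smooth_C1 (dA (dphi U))). now apply smooth_dA, smooth_dphi.
  - apply (smooth_C1 (dphi (dA U))). now apply smooth_dphi, smooth_dA.
Qed.

(** * Algebraic identities of the Poisson bracket *)

Lemma poisson_addl U U' W : smooth U -> smooth U' ->
  poisson (fadd U U') W = fadd (poisson U W) (poisson U' W).
Proof.
  intros HU HU'. apply fn_ext; intros A phi. unfold poisson.
  rewrite dA_add, dphi_add by (now apply smooth_C1). unfold fadd. ring.
Qed.

Lemma poisson_scall c U W : poisson (fscal c U) W = fscal c (poisson U W).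
Proof.
  apply fn_ext; intros A phi. unfold poisson, fscal, dA, dphi.
  rewrite !Derive_scal.
  change (Derive (U A) phi) with (Derive (fun p => U A p) phi). ring.
Qed.

Lemma poisson_antisym U W : poisson U W = fopp (poisson W U).
Proof. apply fn_ext; intros A phi. unfold poisson, fopp. ring. Qed.

(** Every mixed second derivative is written as [dphi (dA _)], so that the Jacobi identity becomes a
    polynomial identity. *)
Lemma dA_poisson U W A phi : smooth U -> smooth W ->
  dA (poisson U W) A phi =
  dA (dA U) A phi * dphi W A phi + dA U A phi * dphi (dA W) A phi
  - (dphi (dA U) A phi * dA W A phi + dphi U A phi * dA (dA W) A phi).
Proof.
  intros HU HW. rewrite <- !smooth_schwarz by assumption.
  assert (HA : forall X, smooth X -> C1_at (dA X) A phi) by (intros; now apply smooth_C1, smooth_dA).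
  assert (Hp : forall X, smooth X -> C1_at (dphi X) A phi) by (intros; now apply smooth_C1, smooth_dphi).
  rewrite <- !dA_mul by auto.
  apply (Derive_minus (fun a => fmul (dA U) (dphi W) a phi) (fun a => fmul (dphi U) (dA W) a phi)).
  - apply (ex_derive_mult (fun a => dA U a phi) (fun a => dphi W a phi)); [apply HA | apply Hp]; assumption.
  - apply (ex_derive_mult (fun a => dphi U a phi) (fun a => dA W a phi)); [apply Hp | apply HA]; assumption.
Qed.

Lemma dphi_poisson U W A phi : smooth U -> smooth W ->
  dphi (poisson U W) A phi =
  dphi (dA U) A phi * dphi W A phi + dA U A phi * dphi (dphi W) A phi
  - (dphi (dphi U) A phi * dA W A phi + dphi U A phi * dphi (dA W) A phi).
Proof.
  intros HU HW.
  assert (HA : forall X, smooth X -> C1_at (dA X) A phi) by (intros; now apply smooth_C1, smooth_dA).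
  assert (Hp : forall X, smooth X -> C1_at (dphi X) A phi) by (intros; now apply smooth_C1, smooth_dphi).
  rewrite <- !dphi_mul by auto.
  apply (Derive_minus (fun p => fmul (dA U) (dphi W) A p) (fun p => fmul (dphi U) (dA W) A p)).
  - apply (ex_derive_mult (fun p => dA U A p) (fun p => dphi W A p)); [apply HA | apply Hp]; assumption.
  - apply (ex_derive_mult (fun p => dphi U A p) (fun p => dA W A p)); [apply Hp | apply HA]; assumption.
Qed.

Lemma poisson_jacobi U V W : smooth U -> smooth V -> smooth W ->
  poisson (poisson U V) W = fsub (poisson U (poisson V W)) (poisson V (poisson U W)).
Proof.
  intros HU HV HW. apply fn_ext; intros A phi. unfold fsub.
  (* Only the outer brackets are unfolded; the derivatives of the inner ones come from the two
     preceding lemmas. *)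
  unfold poisson at 1 3 5. rewrite !dA_poisson, !dphi_poisson by assumption. ring.
Qed.

(** The shift is symplectic: the chain rule adds to each [A]-derivative a multiple of the
    [phi]-derivative with the common factor [dA (dA H)], and these additions cancel by antisymmetry.
    The frequency [dA H] does not depend on the angle, so [phi]-derivatives commute with the
    shift. *)
Lemma exp_action_poisson H U W : smooth H -> action_only H -> smooth U -> smooth W ->
  exp_action H (poisson U W) = poisson (exp_action H U) (exp_action H W).
Proof.
  intros HH Hact HU HW. apply fn_ext; intros A phi.
  assert (H0 : dphi (dA H) A phi = 0).
  { rewrite <- smooth_schwarz by assumption.
    replace (dphi H) with (fconst 0); [now rewrite dA_const|].
    apply fn_ext; intros a p. unfold dphi.
    rewrite (Derive_ext (fun q => H a q) (fun _ => H a p)) by (intros; apply Hact).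
    now rewrite Derive_const. }
  assert (EA : forall X, smooth X -> dA (exp_action H X) A phi =
    exp_action H (dA X) A phi + exp_action H (dphi X) A phi * dA (dA H) A phi).
  { intros X HX. apply is_derive_unique. now apply shift_derive_A. }
  assert (Ep : forall X, smooth X -> dphi (exp_action H X) A phi = exp_action H (dphi X) A phi).
  { intros X HX. rewrite <- (Rmult_1_r (exp_action H (dphi X) A phi)).
    replace 1 with (1 + dphi (dA H) A phi) by (rewrite H0; ring).
    apply is_derive_unique. now apply shift_derive_phi. }
  unfold poisson at 2. rewrite !EA, !Ep by assumption.
  unfold exp_action, poisson. ring.
Qed.

(** The frequency is the same at the shifted angle, so the two shifts are opposite. *)
Lemma exp_action_fopp_l H U : action_only H ->
  exp_action H (exp_action (fopp H) U) = U.
Proof.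
  intros Hact. apply fn_ext; intros A phi. unfold exp_action.
  replace (dA (fopp H) A (phi + dA H A phi)) with (- dA H A phi); [f_equal; ring|].
  unfold dA, fopp. rewrite Derive_opp. f_equal. apply Derive_ext; intros a; apply Hact.
Qed.

Lemma phase_function_exp_action H U : action_only H -> phase_function H ->
  phase_function U -> phase_function (exp_action H U).
Proof.
  intros Hact [HH _] [HU PU]. split.
  - now apply smooth_exp_action.
  - intros A phi. unfold exp_action.
    replace (dA H A (phi + 2 * PI)) with (dA H A phi) by (apply Derive_ext; intros a; apply Hact).
    replace (phi + 2 * PI + dA H A phi) with (phi + dA H A phi + 2 * PI) by ring. apply PU.
Qed.

(** The translation of phi by 2 pi is the flow of 2 pi A. *)
Lemma periodic_exp_action U :
  (forall A phi, U A (phi + 2 * PI) = U A phi) <-> exp_action (fscal (2 * PI) coord_A) U = U.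
Proof.
  assert (E : forall A phi, dA (fscal (2 * PI) coord_A) A phi = 2 * PI).
  { intros A phi. unfold dA, fscal, coord_A. rewrite Derive_scal, Derive_id. ring. }
  split; intros HU.
  - apply fn_ext; intros A phi. unfold exp_action. rewrite E. apply HU.
  - intros A phi. transitivity (exp_action (fscal (2 * PI) coord_A) U A phi); [|now rewrite HU].
    unfold exp_action. now rewrite E.
Qed.

(** Periodicity is invariance under the flow of [2 pi A], and that flow preserves brackets. *)
Lemma periodic_poisson U W : phase_function U -> phase_function W ->
  phase_function (poisson U W).
Proof.
  intros [HU PU] [HW PW]. split; [now apply smooth_poisson|].
  apply periodic_exp_action. rewrite exp_action_poisson; try assumption.
  - apply periodic_exp_action in PU, PW. now rewrite PU, PW.
  - apply smooth_scal, smooth_coord_A.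
  - intros A phi psi. reflexivity.
Qed.

(** * Closure properties of phase functions and their series *)

Lemma phase_function_add U W : phase_function U -> phase_function W -> phase_function (fadd U W).
Proof.
  intros [HU PU] [HW PW]. split; [now apply smooth_add|].
  intros A phi. unfold fadd. now rewrite PU, PW.
Qed.

Lemma phase_function_scal c U : phase_function U -> phase_function (fscal c U).
Proof.
  intros [HU PU]. split; [now apply smooth_scal|]. intros A phi. unfold fscal. now rewrite PU.
Qed.

Lemma phase_function_zero : phase_function fzero.
Proof. split; [apply smooth_const | reflexivity]. Qed.

Lemma phase_function_opp U : phase_function U -> phase_function (fopp U).
Proof.
  intros [HU PU]. split; [now apply smooth_opp|]. intros A phi. unfold fopp. now rewrite PU.
Qed.

Lemma phase_function_sub U W : phase_function U -> phase_function W -> phase_function (fsub U W).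
Proof.
  intros [HU PU] [HW PW]. split; [now apply smooth_sub|].
  intros A phi. unfold fsub. now rewrite PU, PW.
Qed.

(** Linear subspaces of functions; finite sums are treated at once for [smooth] and for
    [phase_function]. *)
Record fn_class (P : fn -> Prop) : Prop := {
  fn_class_zero : P fzero;
  fn_class_add : forall U W, P U -> P W -> P (fadd U W);
  fn_class_scal : forall c U, P U -> P (fscal c U) }.

Lemma smooth_class : fn_class smooth.
Proof. exact (Build_fn_class smooth (smooth_const 0) smooth_add smooth_scal). Qed.

Lemma phase_function_class : fn_class phase_function.
Proof.
  exact (Build_fn_class _ phase_function_zero phase_function_add phase_function_scal).
Qed.

Lemma fn_class_sum_n_m P (F : nat -> fn) a b : fn_class P -> (forall i, P (F i)) ->
  P (fun A phi => sum_n_m (fun i => F i A phi) a b).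
Proof.
  intros HP HF. induction b as [|b IH].
  - destruct a as [|a].
    + replace (fun A phi => sum_n_m (fun i => F i A phi) 0 0) with (F O); [apply HF|].
      apply fn_ext; intros A phi. now rewrite sum_n_n.
    + replace (fun A phi => sum_n_m (fun i => F i A phi) (S a) 0) with fzero;
        [now apply fn_class_zero|].
      apply fn_ext; intros A phi. rewrite sum_n_m_zero; [reflexivity | auto with arith].
  - destruct (Compare_dec.le_lt_dec a (S b)) as [Hab|Hab].
    + replace (fun A phi => sum_n_m (fun i => F i A phi) a (S b)) with
        (fadd (fun A phi => sum_n_m (fun i => F i A phi) a b) (F (S b))).
      * now apply fn_class_add.
      * apply fn_ext; intros A phi. now rewrite sum_n_Sm.
    + replace (fun A phi => sum_n_m (fun i => F i A phi) a (S b)) with fzero;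
        [now apply fn_class_zero|].
      apply fn_ext; intros A phi. now rewrite sum_n_m_zero.
Qed.

Lemma poisson_sum_n (F : nat -> fn) W m A phi : (forall i, smooth (F i)) ->
  poisson (fun a p => sum_n (fun i => F i a p) m) W A phi =
  sum_n (fun i => poisson (F i) W A phi) m.
Proof.
  intros HF. induction m as [|m IH].
  - rewrite sum_O. f_equal. apply fn_ext; intros a p. now rewrite sum_O.
  - rewrite sum_Sn, <- IH.
    replace (fun a p => sum_n (fun i => F i a p) (S m)) with
      (fadd (fun a p => sum_n (fun i => F i a p) m) (F (S m)));
      [|apply fn_ext; intros a p; now rewrite sum_Sn].
    rewrite poisson_addl; [reflexivity | | apply HF].
    now apply (fn_class_sum_n_m smooth F 0 m smooth_class).
Qed.

Lemma fn_class_spoisson P U W m : fn_class P ->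
  (forall i j, P (poisson (U i) (W j))) -> P (spoisson U W m).
Proof.
  intros HP HUW. apply (fn_class_sum_n_m P (fun i => poisson (U i) (W (m - i)%nat))); auto.
Qed.

Lemma phase_series_nested_bracket U W w : phase_series U -> phase_series W ->
  phase_series (nested_bracket U W w).
Proof.
  intros HU HW. assert (HX : forall b : bool, phase_series (if b then U else W)) by now intros [].
  induction w as [|b [|c w] IH]; intros m.
  - apply phase_function_zero.
  - apply HX.
  - apply (fn_class_spoisson _ (if b then U else W)); [apply phase_function_class|].
    intros i j. apply periodic_poisson; [apply HX | apply IH].
Qed.

Lemma phase_series_boxplus U W : phase_series U -> phase_series W -> phase_series (boxplus U W).
Proof.
  intros HU HW m.
  apply (fn_class_sum_n_m phase_function (fun n A phi => fold_right Rplus 0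
    (map (fun w => bch_coeff w / INR n * nested_bracket U W w m A phi) (words n))));
    [apply phase_function_class|].
  intros n. induction (words n) as [|w ws IH]; [apply phase_function_zero|].
  apply (phase_function_add (fscal (bch_coeff w / INR n) (nested_bracket U W w m))); [|exact IH].
  apply phase_function_scal. now apply phase_series_nested_bracket.
Qed.

From mathcomp Require Import all_boot all_order all_algebra.
From mathcomp Require Import ring boolp Rstruct.
Set Implicit Arguments. Unset Strict Implicit. Unset Printing Implicit Defensive.
Import Order.TTheory GRing.Theory Num.Theory.
Local Open Scope ring_scope.

(** * Formal exponentials and the Baker-Campbell-Hausdorff series *)

Section TriangularSums.
Variable V : zmodType.
Implicit Type F : nat -> nat -> V.

Lemma sum_antidiagonals N F :
  \sum_(n < N.+1) \sum_(a < n.+1) F a (n - a)%N =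
  \sum_(a < N.+1) \sum_(b < (N - a).+1) F a b.
Proof.
elim: N => [|N IH]; first by rewrite !big_ord1.
rewrite big_ord_recr /= IH [RHS]big_ord_recr /= subnn big_ord1.
rewrite [\sum_(a < N.+2) _]big_ord_recr /= subnn addrA -big_split /=.
by congr (_ + _); apply: eq_bigr => a _; rewrite subSn ?[RHS]big_ord_recr // -ltnS.
Qed.

(** The Cauchy product of truncated series: the part of the square beyond the last antidiagonal
    vanishes, which leaves the triangle. *)
Lemma sum_square N F :
    (forall a b, (N < a + b)%N -> F a b = 0) ->
  \sum_(a < N.+1) \sum_(b < N.+1) F a b =
  \sum_(n < N.+1) \sum_(a < n.+1) F a (n - a)%N.
Proof.
move=> F0; rewrite sum_antidiagonals; apply: eq_bigr => a _.
rewrite [RHS](big_ord_widen N.+1 (F a)) ?ltnS ?leq_subr //.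
rewrite [RHS]big_mkcond; apply: eq_bigr => b _; case: ifP => // /negbT.
by rewrite ltnS -ltnNge ltn_subLR -1?ltnS // => /F0.
Qed.

Lemma sum_triangle_exchange N F :
  \sum_(a < N.+1) \sum_(b < (N - a).+1) F a b =
  \sum_(b < N.+1) \sum_(a < (N - b).+1) F a b.
Proof.
rewrite -sum_antidiagonals -(sum_antidiagonals N (fun b a => F a b)).
apply: eq_bigr => n _; rewrite (reindex_inj rev_ord_inj) /=.
by apply: eq_bigr => a _; rewrite subSS subKn // -ltnS.
Qed.

End TriangularSums.

(** * Iterated commutators in an associative algebra *)

Section IteratedCommutators.
Variables (K : numFieldType) (A : algType K).
Implicit Types Z T : A.

Definition commutator Z T := Z * T - T * Z.
Definition ad k Z T := iter k (commutator Z) T.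

Lemma mulr_ad Z T a b : Z * (ad a Z T * Z ^+ b) = ad a.+1 Z T * Z ^+ b + ad a Z T * Z ^+ b.+1.
Proof. by rewrite exprS !mulrA -mulrDl /= subrK. Qed.

(** Left multiplication by [Z] is the sum of two commuting operators, the commutator with [Z] and
    right multiplication by [Z]; this is the binomial theorem for its [n]-th power. *)
Lemma exprM_ad Z T n :
  Z ^+ n * T = \sum_(a < n.+1) (ad a Z T * Z ^+ (n - a)) *+ 'C(n, a).
Proof.
elim: n => [|n IH]; first by rewrite big_ord1 mul1r mulr1.
rewrite exprS -mulrA IH mulr_sumr.
under eq_bigr => a _ do rewrite mulrnAr mulr_ad mulrnDl.
rewrite big_split /= addrC [RHS]big_ord_recl /= bin0.
under [in RHS]eq_bigr => a _ do rewrite /bump /= add1n binS mulrnDr subSS.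
rewrite big_split /= addrA; congr (_ + _); rewrite [LHS]big_ord_recl /= bin0 !subn0.
congr (_ + _); rewrite [RHS]big_ord_recr /= bin_small // mulr0n addr0.
by apply: eq_bigr => a _; rewrite /bump /= add1n -subSn.
Qed.

(** With [l], [r] the left and right multiplications by [Z] and [l = r + ad], the left side is
    formally [((r + ad)^(n+1) - r^(n+1)) / ad] applied to [T], whence the binomials shifted by
    one. *)
Lemma sum_exprMexpr_ad Z T n :
  \sum_(i < n.+1) Z ^+ i * T * Z ^+ (n - i) =
  \sum_(a < n.+1) (ad a Z T * Z ^+ (n - a)) *+ 'C(n.+1, a.+1).
Proof.
elim: n => [|n IH]; first by rewrite !big_ord1 binn mul1r.
rewrite big_ord_recr /= subnn mulr1 exprM_ad.
have -> : \sum_(i < n.+1) Z ^+ i * T * Z ^+ (n.+1 - i) =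
    (\sum_(i < n.+1) Z ^+ i * T * Z ^+ (n - i)) * Z.
  rewrite mulr_suml; apply: eq_bigr => i _.
  by rewrite subSn -1?ltnS // exprSr !mulrA.
rewrite IH mulr_suml [in RHS]big_ord_recr /= binn.
under [in RHS]eq_bigr => a _ do rewrite binS mulrnDr.
rewrite big_split /= [X in _ + X = _]big_ord_recr /= binn -!addrA; congr (_ + _).
by apply: eq_bigr => a _; rewrite mulrnAl -mulrA -exprSr -subSn // -ltnS.
Qed.

Lemma bin_fact_inv n a : (a <= n)%N ->
  (n`!%:R)^-1 * 'C(n, a)%:R = (a`!%:R)^-1 * ((n - a)`!%:R)^-1 :> K.
Proof.
move=> an; rewrite -(bin_fact an) !natrM invfM mulrC mulVKf ?invfM //.
by rewrite pnatr_eq0 -lt0n bin_gt0.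
Qed.

(** The part of degree [n] in [Z] of [e^Z T = (e^{ad_Z} T) e^Z]. *)
Lemma exprM_ad_fact Z T n :
  (n`!%:R)^-1 *: (Z ^+ n * T) =
  \sum_(a < n.+1) ((a`!%:R)^-1 *: ad a Z T) * (((n - a)`!%:R)^-1 *: Z ^+ (n - a)).
Proof.
rewrite exprM_ad scaler_sumr; apply: eq_bigr => a _.
by rewrite -scaler_nat scalerA -scalerAl -scalerAr scalerA bin_fact_inv // -ltnS.
Qed.

(** For a derivation [D] with [D Z = T], this is one homogeneous part of
    [D (e^Z) = (sum_k ad_Z^k T / (k+1)!) e^Z]. *)
Lemma sum_exprMexpr_ad_fact Z T n :
  (n.+1`!%:R)^-1 *: (\sum_(i < n.+1) Z ^+ i * T * Z ^+ (n - i)) =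
  \sum_(a < n.+1) ((a.+1`!%:R)^-1 *: ad a Z T) * (((n - a)`!%:R)^-1 *: Z ^+ (n - a)).
Proof.
rewrite sum_exprMexpr_ad scaler_sumr; apply: eq_bigr => a _.
by rewrite -scaler_nat scalerA -scalerAl -scalerAr scalerA bin_fact_inv // subSS.
Qed.

End IteratedCommutators.

(** * Truncated exponential and logarithm *)

Section ExpLog.
Variable K : numFieldType.

Definition exp_trunc (A : algType K) N (Z : A) : A :=
  \sum_(k < N.+1) (k`!%:R)^-1 *: Z ^+ k.

(** A truncation of [log (1 + Z)], with the summation index shifted by one. *)
Definition log_trunc (A : algType K) N (Z : A) : A :=
  \sum_(k < N) ((-1) ^+ k / k.+1%:R) *: Z ^+ k.+1.

(** The derivative is a finite geometric sum, and multiplication by [1 + X] telescopes it. *)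
Lemma deriv_log_trunc N :
  (1 + 'X) * (log_trunc N ('X : {poly K}))^`() = 1 - (- 'X) ^+ N.
Proof.
have -> : (log_trunc N ('X : {poly K}))^`() = \sum_(k < N) (- 'X) ^+ k.
  rewrite /log_trunc raddf_sum; apply: eq_bigr => k _.
  rewrite /= derivZ derivXn -scaler_nat scalerA mulfVK ?pnatr_eq0 //=.
  by rewrite -[in RHS]scaleN1r exprZn.
by rewrite -[RHS]opprB subrX1 -mulNr opprB opprK.
Qed.

Lemma deriv_exp_trunc N (p : {poly K}) :
  (exp_trunc N p)^`() = (exp_trunc N p - (N`!%:R)^-1 *: p ^+ N) * p^`().
Proof.
rewrite /exp_trunc [in RHS]big_ord_recr /= addrK.
rewrite raddf_sum big_ord_recl /= expr0 derivZ derivC scaler0 add0r mulr_suml.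
apply: eq_bigr => i _; rewrite /= /bump /= add1n derivZ deriv_exp /= -scaler_nat scalerA.
rewrite -scalerAl [in RHS]mulrC factS natrM invfM mulrAC mulVf ?mul1r //.
by rewrite pnatr_eq0.
Qed.

Lemma coef0_log_trunc N : (log_trunc N ('X : {poly K}))`_0 = 0.
Proof. by rewrite coef_sum big1 // => k _; rewrite coefZ coefXn mulr0. Qed.

(** [E = exp (log (1 + X))] solves [(1 + X) E' = E] with [E(0) = 1]. *)
Lemma exp_log_trunc_polyX N :
  exists q : {poly K}, exp_trunc N (log_trunc N 'X) = 1 + 'X + q * 'X^(N.+1).
Proof.
set L := log_trunc N 'X; set E := exp_trunc N L.
have L0n n : (0 < n)%N -> (L ^+ n)`_0 = 0.
  by case: n => // n _; rewrite exprS coef0M coef0_log_trunc mul0r.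
have Ln n i : (i < n)%N -> (L ^+ n)`_i = 0.
  have [M ->] : exists M, L = 'X * M.
    exists (\sum_(k < N) ((-1) ^+ k / k.+1%:R) *: 'X^k).
    rewrite mulr_sumr; apply: eq_bigr => k _.
    by rewrite -scalerAr exprS.
  by move=> lt_in; rewrite exprMn coefXnM lt_in.
have E0 : E`_0 = 1.
  rewrite coef_sum big_ord_recl /= expr0 coefZ coef1 fact0 invr1 mul1r.
  by rewrite big1 ?addr0 // => k _; rewrite coefZ L0n ?mulr0.
(* The errors of both truncations are divisible by [X^N], so below degree [N] the differential
   equation holds exactly. *)
have ode i : (i < N)%N -> E`_i.+1 *+ i.+1 + E`_i *+ i = E`_i.
  move=> iN.
  have : ((1 + 'X) * E^`())`_i = ((E - (N`!%:R)^-1 *: L ^+ N) * (1 - (- 'X) ^+ N))`_i.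
    by rewrite deriv_exp_trunc mulrCA deriv_log_trunc.
  rewrite mulrDl mul1r coefD coefXM coef_deriv => eqE.
  have -> : E`_i *+ i = (if i == 0%N then 0 else E^`()`_i.-1).
    by case: (i : nat) => // j; rewrite coef_deriv.
  rewrite eqE mulrBr mulr1 -(scaleN1r ('X : {poly K})) exprZn -scalerAr coefB coefZ coefMXn iN mulr0 subr0.
  by rewrite coefB coefZ Ln // mulr0 subr0.
(* The recursion gives [E_1 = E_0 = 1]; at [i = 1] the factor [1 - i] makes [E_2] vanish, and all
   later coefficients follow. *)
have Ei i : (i <= N)%N -> E`_i = (1 + 'X)`_i.
  elim: i => [|[|i] IH] iN; rewrite coefD coef1 coefX ?addr0 ?add0r //.
    by have := ode 0%N iN; rewrite mulr0n addr0 mulr1n E0.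
  have := ode i.+1 iN; rewrite IH 1?ltnW // coefD coef1 coefX add0r.
  case: i {IH} iN => [|i] iN; rewrite ?mulr0n ?mul0rn ?addr0 => /eqP.
    by rewrite mulr1n -[X in _ == X]add0r (inj_eq (addIr _)) mulrn_eq0 => /eqP.
  by rewrite mulrn_eq0 => /eqP.
exists (drop_poly N.+1 (E - (1 + 'X))).
rewrite -[LHS](subrK (1 + 'X)) addrC -[in LHS](poly_take_drop N.+1 (E - _)).
congr (_ + _); rewrite -[RHS]add0r; congr (_ + _).
apply/polyP => i; rewrite coef_take_poly coef0; case: ifP => // iN.
by rewrite coefB Ei ?subrr // -ltnS.
Qed.

(** Only powers of the single element [g] occur, so the identity of commutative polynomials can be
    evaluated at [g]. *)
Lemma exp_log_trunc (A : algType K) N (g : A) :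
  exists q : A, exp_trunc N (log_trunc N g) = 1 + g + q * g ^+ N.+1.
Proof.
have [q Eq] := exp_log_trunc_polyX N; exists (horner_alg g q).
have := congr1 (horner_alg g) Eq.
rewrite !rmorphD !rmorphM rmorph1 rmorphXn /= !horner_algX => <-.
rewrite /exp_trunc /log_trunc linear_sum; apply: eq_bigr => k _.
rewrite [RHS]linearZ /= mulr_algl rmorphXn /= [in RHS]linear_sum /=.
congr (_ *: _ ^+ _); apply: eq_bigr => j _.
by rewrite linearZ /= mulr_algl rmorphXn /= horner_algX.
Qed.

End ExpLog.

(** * The algebra of noncommutative power series in two letters *)

Record ncs (K : Type) := NCS { ncoef :> seq bool -> K }.

HB.instance Definition _ (K : Type) := gen_eqMixin (ncs K).
HB.instance Definition _ (K : Type) := gen_choiceMixin (ncs K).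

Lemma ncsP (K : Type) (p q : ncs K) : ncoef p =1 ncoef q -> p = q.
Proof. by case: p q => [p] [q] /= /funext ->. Qed.

Section NoncommutativeSeries.
Variable K : numFieldType.
Local Notation A := (ncs K).
Implicit Types (p q r : A) (w : seq bool) (b : bool).

Definition ncs_add p q : A := NCS (fun w => p w + q w).
Definition ncs_opp p : A := NCS (fun w => - p w).
Definition ncs_zero : A := NCS (fun=> 0).
Definition ncs_scale (c : K) p : A := NCS (fun w => c * p w).

Lemma ncs_addA : associative ncs_add.
Proof. by move=> p q r; apply/ncsP => w /=; rewrite addrA. Qed.
Lemma ncs_addC : commutative ncs_add.
Proof. by move=> p q; apply/ncsP => w /=; rewrite addrC. Qed.
Lemma ncs_add0 : left_id ncs_zero ncs_add.
Proof. by move=> p; apply/ncsP => w /=; rewrite add0r. Qed.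
Lemma ncs_addN : left_inverse ncs_zero ncs_opp ncs_add.
Proof. by move=> p; apply/ncsP => w /=; rewrite addNr. Qed.

HB.instance Definition _ :=
  GRing.isZmodule.Build A ncs_addA ncs_addC ncs_add0 ncs_addN.

Lemma ncs_scaleA c d p : ncs_scale c (ncs_scale d p) = ncs_scale (c * d) p.
Proof. by apply/ncsP => w /=; rewrite mulrA. Qed.
Lemma ncs_scale1 : left_id 1 ncs_scale.
Proof. by move=> p; apply/ncsP => w /=; rewrite mul1r. Qed.
Lemma ncs_scaleDr : right_distributive ncs_scale +%R.
Proof. by move=> c p q; apply/ncsP => w /=; rewrite mulrDr. Qed.
Lemma ncs_scaleDl p : {morph ncs_scale^~ p : c d / c + d}.
Proof. by move=> c d; apply/ncsP => w /=; rewrite mulrDl. Qed.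

HB.instance Definition _ := GRing.Zmodule_isLmodule.Build K A
  ncs_scaleA ncs_scale1 ncs_scaleDr ncs_scaleDl.

Lemma ncs_coefD p q w : (p + q) w = p w + q w. Proof. by []. Qed.
Lemma ncs_coefB p q w : (p - q) w = p w - q w. Proof. by []. Qed.
Lemma ncs_coef0 w : (0 : A) w = 0. Proof. by []. Qed.
Lemma ncs_coefZ c p w : (c *: p) w = c * p w. Proof. by []. Qed.
Lemma ncs_coef_sum (I : Type) (s : seq I) (P : pred I) (F : I -> A) w :
  (\sum_(i <- s | P i) F i) w = \sum_(i <- s | P i) F i w.
Proof. exact: (big_morph (fun p : A => p w) (fun p q => ncs_coefD p q w) (ncs_coef0 w)). Qed.

(** [p] is [p [::]] plus the sum over [b] of the letter [b] times [lquo b p];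
    the product is defined by the corresponding Leibniz rule [lquoM]. *)
Definition lquo b p : A := NCS (fun w => p (b :: w)).

Fixpoint mulw (p q : A) w : K :=
  if w is b :: w' then mulw (lquo b p) q w' + p [::] * q w else p [::] * q [::].
Definition ncs_mul p q : A := NCS (mulw p q).
Definition ncs_one : A := NCS (fun w => (nilp w)%:R).

Lemma lquoD b p q : lquo b (p + q) = lquo b p + lquo b q. Proof. by []. Qed.
Lemma lquoZ b c p : lquo b (c *: p) = c *: lquo b p. Proof. by []. Qed.

Lemma ncs_mulDl : left_distributive ncs_mul +%R.
Proof.
move=> p q r; apply/ncsP => /= w; elim: w p q => [|b w IH] p q /=.
  by rewrite mulrDl.
by rewrite lquoD IH mulrDl !addrA; congr (_ + _); rewrite addrAC.
Qed.

Lemma ncs_mulDr : right_distributive ncs_mul +%R.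
Proof.
move=> p q r; apply/ncsP => /= w; elim: w p => [|b w IH] p /=.
  by rewrite mulrDr.
by rewrite IH mulrDr !addrA; congr (_ + _); rewrite addrAC.
Qed.

Lemma ncs_scaleAl c p q : c *: ncs_mul p q = ncs_mul (c *: p) q.
Proof.
apply/ncsP => /= w; elim: w p => [|b w IH] p /=; first by rewrite mulrA.
by rewrite mulrDr mulrA lquoZ -IH.
Qed.

Lemma ncs_scaleAr c p q : c *: ncs_mul p q = ncs_mul p (c *: q).
Proof.
apply/ncsP => /= w; elim: w p => [|b w IH] p /=; first by rewrite mulrCA.
by rewrite mulrDr IH mulrCA.
Qed.

Lemma lquo_mul b p q : lquo b (ncs_mul p q) = ncs_mul (lquo b p) q + p [::] *: lquo b q.
Proof. by []. Qed.

Lemma ncs_mulA : associative ncs_mul.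
Proof.
move=> p q r; apply/ncsP => w; elim: w p q => [|b w IH] p q /=; first by rewrite mulrA.
have /= -> := IH (lquo b p) q.
by rewrite lquo_mul -[mulw (_ + _) _ _]/(ncs_mul _ _ _) ncs_mulDl -ncs_scaleAl ncs_coefD ncs_coefZ
  mulrDr mulrA addrA.
Qed.

Lemma ncs_mul0 p : ncs_mul 0 p = 0.
Proof. by rewrite -(scale0r (0 : A)) -ncs_scaleAl !scale0r. Qed.

Lemma ncs_mul1 : left_id ncs_one ncs_mul.
Proof.
move=> p; apply/ncsP => -[|b w] /=; rewrite mul1r //.
have -> : lquo b ncs_one = 0 by [].
by rewrite -[mulw _ _ _]/(ncs_mul _ _ _) ncs_mul0 add0r.
Qed.

Lemma ncs_mulr1 : right_id ncs_one ncs_mul.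
Proof.
move=> p; apply/ncsP => w; elim: w p => [|b w IH] p /=; first by rewrite mulr1.
by have /= -> := IH (lquo b p); rewrite mulr0 addr0.
Qed.

Lemma ncs_one_neq0 : ncs_one != 0.
Proof.
by apply/eqP => /(congr1 (fun p : A => p [::])) /eqP; rewrite ncs_coef0 oner_eq0.
Qed.

HB.instance Definition _ := GRing.Zmodule_isNzRing.Build A
  ncs_mulA ncs_mul1 ncs_mulr1 ncs_mulDl ncs_mulDr ncs_one_neq0.
HB.instance Definition _ := GRing.Lmodule_isLalgebra.Build K A ncs_scaleAl.
HB.instance Definition _ := GRing.Lalgebra_isAlgebra.Build K A ncs_scaleAr.

Lemma ncs_coef1 w : (1 : A) w = (nilp w)%:R. Proof. by []. Qed.
Lemma ncs_coefM_nil p q : (p * q) [::] = p [::] * q [::]. Proof. by []. Qed.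
Lemma lquoM b p q : lquo b (p * q) = lquo b p * q + p [::] *: lquo b q.
Proof. by []. Qed.
Lemma ncs_coefM_cons p q b w : (p * q) (b :: w) = (lquo b p * q) w + p [::] * q (b :: w).
Proof. by []. Qed.

(** * The filtration by word length and congruence modulo long words *)

Definition ord_ge n p := forall w, (size w < n)%N -> p w = 0.
Definition eqm N p q := forall w, (size w <= N)%N -> p w = q w.

Lemma ord_ge_leq m n p : (m <= n)%N -> ord_ge n p -> ord_ge m p.
Proof. by move=> mn pn w wm; apply: pn; apply: leq_trans mn. Qed.

Lemma ord_geD n p q : ord_ge n p -> ord_ge n q -> ord_ge n (p + q).
Proof. by move=> pn qn w wn; rewrite ncs_coefD pn ?qn ?addr0. Qed.

Lemma ord_geB n p q : ord_ge n p -> ord_ge n q -> ord_ge n (p - q).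
Proof. by move=> pn qn w wn; rewrite ncs_coefB pn ?qn ?subr0. Qed.

Lemma ord_geZ n c p : ord_ge n p -> ord_ge n (c *: p).
Proof. by move=> pn w wn; rewrite ncs_coefZ pn ?mulr0. Qed.

Lemma ord_geM m n p q : ord_ge m p -> ord_ge n q -> ord_ge (m + n) (p * q).
Proof.
move=> pm qn w; elim: w m p pm => [|b w IH] m p pm wmn.
  rewrite ncs_coefM_nil; case: m pm wmn => [|m] pm; last by rewrite pm ?mul0r.
  by move=> wn; rewrite qn ?mulr0.
rewrite ncs_coefM_cons (IH m.-1) ?add0r.
- case: m pm wmn => [|m] pm wmn; last by rewrite pm ?mul0r.
  by rewrite qn ?mulr0.
- by move=> v vm; apply: pm; case: m {wmn} vm.
- by case: m {pm} wmn => //= wn; apply: ltnW.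
Qed.

Lemma ord_geX p k : ord_ge 1 p -> ord_ge k (p ^+ k).
Proof. by move=> p1; elim: k => [|k IH] //; rewrite exprS -add1n; apply: ord_geM. Qed.

Lemma ord_ge_ad n Z T k : ord_ge 1 Z -> ord_ge n T -> ord_ge (k + n) (ad k Z T).
Proof.
move=> Z1 Tn; elim: k => [|k IH] //.
have -> : (k.+1 + n = 1 + (k + n))%N by [].
by apply: ord_geB; [|rewrite addnC]; apply: ord_geM.
Qed.

Lemma eqm_refl N p : eqm N p p. Proof. by []. Qed.
Lemma eqm_sym N p q : eqm N p q -> eqm N q p.
Proof. by move=> pq w wN; rewrite pq. Qed.
Lemma eqm_trans N p q r : eqm N p q -> eqm N q r -> eqm N p r.
Proof. by move=> pq qr w wN; rewrite pq ?qr. Qed.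
Lemma eqmD N p q p' q' : eqm N p p' -> eqm N q q' -> eqm N (p + q) (p' + q').
Proof. by move=> pp qq w wN; rewrite !ncs_coefD pp ?qq. Qed.
Lemma eqmZ N c p p' : eqm N p p' -> eqm N (c *: p) (c *: p').
Proof. by move=> pp w wN; rewrite !ncs_coefZ pp. Qed.
Lemma eqm_sum N (I : Type) (s : seq I) (P : pred I) (F G : I -> A) :
  (forall i, P i -> eqm N (F i) (G i)) ->
  eqm N (\sum_(i <- s | P i) F i) (\sum_(i <- s | P i) G i).
Proof. by move=> FG w wN; rewrite !ncs_coef_sum; apply: eq_bigr => i Pi; apply: FG. Qed.

Lemma eqm_ord N p q : ord_ge N.+1 (p - q) <-> eqm N p q.
Proof.
split=> pq w wN; last by rewrite ncs_coefB pq // subrr.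
by apply/eqP; rewrite -subr_eq0 -ncs_coefB pq.
Qed.

Lemma eqmM N p q p' q' : eqm N p p' -> eqm N q q' -> eqm N (p * q) (p' * q').
Proof.
move=> /eqm_ord pp /eqm_ord qq; apply/eqm_ord.
have -> : p * q - p' * q' = (p - p') * q + p' * (q - q').
  by rewrite mulrBl mulrBr addrA subrK.
apply: ord_geD; last by rewrite -[N.+1]add0n; apply: ord_geM.
by rewrite -[N.+1]addn0; apply: ord_geM.
Qed.

Lemma eqmX N p q k : eqm N p q -> eqm N (p ^+ k) (q ^+ k).
Proof. by move=> pq; elim: k => // k IH; rewrite !exprS; apply: eqmM. Qed.

Lemma eqm_exp_trunc N p q : eqm N p q -> eqm N (exp_trunc N p) (exp_trunc N q).
Proof. by move=> pq; apply: eqm_sum => k _; apply: eqmZ; apply: eqmX. Qed.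

Lemma eqm_sum_square N (F : nat -> nat -> A) :
    (forall i j, ord_ge (i + j) (F i j)) ->
  eqm N (\sum_(n < N.+1) \sum_(a < n.+1) F a (n - a)%N)
        (\sum_(a < N.+1) \sum_(b < N.+1) F a b).
Proof.
move=> Ford w wN; rewrite !ncs_coef_sum.
under eq_bigr => n _ do rewrite ncs_coef_sum.
under [in RHS]eq_bigr => n _ do rewrite ncs_coef_sum.
rewrite (@sum_square _ N (fun i j => F i j w)) // => i j Nij.
by apply: Ford; apply: leq_ltn_trans Nij.
Qed.

(** Since [r - 1] has order at least one, [p - q = (p - q) r - (p - q) (r - 1)] raises the known
    order of [p - q] by one at each step. *)
Lemma eqm_mulIr N p q r : r [::] = 1 -> eqm N (p * r) (q * r) -> eqm N p q.
Proof.
move=> r1 /eqm_ord; rewrite -mulrBl => pqr; apply/eqm_ord.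
have r1ord : ord_ge 1 (r - 1) by case=> // _; rewrite ncs_coefB ncs_coef1 r1 subrr.
suff main n : (n <= N.+1)%N -> ord_ge n (p - q) by apply: main.
elim: n => // n IH nN.
have -> : p - q = (p - q) * r - (p - q) * (r - 1).
  by rewrite mulrBr mulr1 subKr.
apply: ord_geB; first exact: ord_ge_leq pqr.
by rewrite -addn1; apply: ord_geM => //; apply: IH; apply: ltnW.
Qed.

(** * The derivation multiplying a word by its length *)

Definition deg p : A := NCS (fun w => (size w)%:R * p w).

Lemma degD p q : deg (p + q) = deg p + deg q.
Proof. by apply/ncsP => w; rewrite /= mulrDr. Qed.

Lemma degZ c p : deg (c *: p) = c *: deg p.
Proof. by apply/ncsP => w; rewrite /= mulrCA. Qed.

Lemma deg_sum (I : Type) (s : seq I) (P : pred I) (F : I -> A) :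
  deg (\sum_(i <- s | P i) F i) = \sum_(i <- s | P i) deg (F i).
Proof.
by apply: (big_morph deg degD); apply/ncsP => w; rewrite /= mulr0.
Qed.

Lemma deg1 : deg 1 = 0.
Proof. by apply/ncsP => -[|b w] /=; rewrite ?mul0r ?mulr0. Qed.

Lemma ord_ge_deg p : ord_ge 1 (deg p).
Proof. by case=> // _; rewrite /= mul0r. Qed.

Lemma eqm_deg N p q : eqm N p q -> eqm N (deg p) (deg q).
Proof. by move=> pq w wN; rewrite /= pq. Qed.

Lemma lquo_deg b p : lquo b (deg p) = deg (lquo b p) + lquo b p.
Proof. by apply/ncsP => w; rewrite /= -natr1 mulrDl mul1r. Qed.

Lemma degM p q : deg (p * q) = deg p * q + p * deg q.
Proof.
apply/ncsP => w; elim: w p => [|b w IH] p.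
  by rewrite ncs_coefD !ncs_coefM_nil /= !mul0r mulr0 addr0.
have Eq : (lquo b (deg p) * q) w = (deg (lquo b p) * q) w + (lquo b p * q) w.
  by rewrite lquo_deg mulrDl.
have := IH (lquo b p); rewrite /= in Eq *; rewrite Eq => {}IH.
by rewrite mulrDr -natr1 !mulrDl IH; ring.
Qed.

Lemma degX p n : deg (p ^+ n.+1) = \sum_(i < n.+1) p ^+ i * deg p * p ^+ (n - i).
Proof.
elim: n => [|n IH]; first by rewrite big_ord1 mul1r mulr1.
rewrite exprSr degM IH mulr_suml [in RHS]big_ord_recr /= subnn mulr1; congr (_ + _).
by apply: eq_bigr => i _; rewrite -mulrA -exprSr -subSn // -ltnS.
Qed.

(** The derivative of the exponential: the Leibniz rule in each power of [p], followed by
    [sum_exprMexpr_ad_fact] with [T = deg p]. *)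
Lemma deg_exp_trunc N p : ord_ge 1 p ->
  eqm N (deg (exp_trunc N p))
        ((\sum_(k < N.+1) (k.+1`!%:R)^-1 *: ad k p (deg p)) * exp_trunc N p).
Proof.
move=> p1.
pose F i j := ((i.+1`!%:R)^-1 *: ad i p (deg p)) * ((j`!%:R)^-1 *: p ^+ j).
have Ford i j : ord_ge (i + j).+1 (F i j).
  rewrite -addSn; apply: ord_geM; apply: ord_geZ; last exact: ord_geX.
  by rewrite -addn1; apply: ord_ge_ad => //; apply: ord_ge_deg.
have -> : deg (exp_trunc N p) = \sum_(n < N) \sum_(i < n.+1) F i (n - i)%N.
  rewrite deg_sum big_ord_recl /= expr0 degZ deg1 scaler0 add0r.
  by apply: eq_bigr => n _; rewrite /bump add1n degZ degX sum_exprMexpr_ad_fact.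
(* The constant term of the exponential is killed by [deg], so the sum has one antidiagonal too few;
   the missing one has order [N + 1], because [deg p] itself has order at least one. *)
apply: (@eqm_trans _ _ (\sum_(n < N.+1) \sum_(i < n.+1) F i (n - i)%N)).
  move=> w wN; rewrite [in RHS]big_ord_recr ncs_coefD.
  rewrite [X in _ = _ + X]ncs_coef_sum [X in _ = _ + X]big1 ?addr0 // => i _.
  by apply: Ford; rewrite subnKC // -ltnS.
apply: eqm_trans; first apply: eqm_sum_square.
  by move=> i j; apply: ord_ge_leq (Ford i j).
rewrite mulr_suml; apply: eqm_sum => i _.
by rewrite mulr_sumr; apply: eqm_refl.
Qed.

Lemma exp_truncM N p q : ord_ge 1 p ->
  eqm N (exp_trunc N p * q)
        ((\sum_(k < N.+1) (k`!%:R)^-1 *: ad k p q) * exp_trunc N p).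
Proof.
move=> p1.
pose F i j := ((i`!%:R)^-1 *: ad i p q) * ((j`!%:R)^-1 *: p ^+ j).
have -> : exp_trunc N p * q = \sum_(n < N.+1) \sum_(i < n.+1) F i (n - i)%N.
  by rewrite mulr_suml; apply: eq_bigr => n _; rewrite -scalerAl exprM_ad_fact.
apply: eqm_trans; first apply: eqm_sum_square.
  move=> i j; apply: ord_geM; apply: ord_geZ; last exact: ord_geX.
  by rewrite -[X in ord_ge X]addn0; apply: ord_ge_ad.
rewrite mulr_suml; apply: eqm_sum => i _.
by rewrite mulr_sumr; apply: eqm_refl.
Qed.

(** * Letters, their exponentials, and the logarithm *)

Definition letter b : A := NCS (fun w => (w == [:: b])%:R).

Definition exp_letter b : A :=
  NCS (fun w => if all (pred1 b) w then ((size w)`!%:R)^-1 else 0).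

Lemma ord_ge_letter b : ord_ge 1 (letter b).
Proof. by case. Qed.

Lemma lquo_letter b c : lquo c (letter b) = (c == b)%:R *: 1.
Proof.
by apply/ncsP => w; rewrite ncs_coefZ /= eqseq_cons -natrM mulnb; case: w.
Qed.

Lemma letterM b p c w : (letter b * p) (c :: w) = (c == b)%:R * p w.
Proof.
by rewrite ncs_coefM_cons lquo_letter -scalerAl mul1r /= mul0r addr0.
Qed.

Lemma letterX b k w : (letter b ^+ k) w = (all (pred1 b) w && (size w == k))%:R.
Proof.
elim: k w => [|k IH] [|c w] //=; first by rewrite andbF.
  by rewrite exprS ncs_coefM_nil mul0r.
by rewrite exprS letterM IH /= -natrM mulnb eqSS andbA.
Qed.

Lemma exp_letter_trunc N b : eqm N (exp_letter b) (exp_trunc N (letter b)).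
Proof.
move=> w wN; rewrite ncs_coef_sum /=.
rewrite (bigD1 (Ordinal (wN : (size w < N.+1)%N))) //= letterX eqxx andbT big1 ?addr0.
  by case: all; rewrite ?mulr1 ?mulr0.
move=> k; rewrite -val_eqE /= => kw; rewrite letterX.
by rewrite eq_sym (negPf kw) andbF mulr0.
Qed.

Lemma deg_exp_letter b : deg (exp_letter b) = letter b * exp_letter b.
Proof.
apply/ncsP => -[|c w]; first by rewrite ncs_coefM_nil /= !mul0r.
rewrite letterM /=; case: (c == b); rewrite /= ?mul0r ?mulr0 // mul1r.
by case: ifP; rewrite ?mulr0 // factS natrM invfM mulrA mulfV ?mul1r // pnatr_eq0.
Qed.

(** On a word, powers of [p - 1] beyond its length vanish when [p] has constant term 1, so the
    truncation may depend on the word. *)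
Definition ncs_log p : A := NCS (fun w => log_trunc (size w) (p - 1) w).

Lemma ord_ge_subr1 p : p [::] = 1 -> ord_ge 1 (p - 1).
Proof. by move=> p1 [] // _; rewrite ncs_coefB ncs_coef1 p1 subrr. Qed.

Lemma eqm_log N p : p [::] = 1 -> eqm N (ncs_log p) (log_trunc N (p - 1)).
Proof.
move=> p1 w wN /=; rewrite /log_trunc !ncs_coef_sum.
rewrite (big_ord_widen N (fun k => (((-1) ^+ k / k.+1%:R) *: (p - 1) ^+ k.+1) w)) //.
rewrite big_mkcond; apply: eq_bigr => k _; case: ifP => // /negbT; rewrite -leqNgt => wk.
by rewrite ncs_coefZ (ord_geX (ord_ge_subr1 p1)) ?mulr0.
Qed.

Lemma ord_ge_log p : ord_ge 1 (ncs_log p).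
Proof. by case=> // _; rewrite /= /log_trunc big_ord0. Qed.

(** The remainder in [exp_log_trunc] is a multiple of [(p - 1)^(N+1)], which has order [N + 1]. *)
Lemma exp_trunc_log N p : p [::] = 1 -> eqm N (exp_trunc N (ncs_log p)) p.
Proof.
move=> p1; apply: eqm_trans (eqm_exp_trunc (eqm_log p1)) _.
have [q ->] := exp_log_trunc N (p - 1); apply/eqm_ord.
rewrite [1 + _]addrC subrK addrAC subrr add0r.
by rewrite -[N.+1]add0n; apply: ord_geM => //; apply/ord_geX/ord_ge_subr1.
Qed.

Definition bch : A := ncs_log (exp_letter true * exp_letter false).

Lemma exp_letters_nil : (exp_letter true * exp_letter false) [::] = 1.
Proof. by rewrite ncs_coefM_nil /= fact0 invr1 mulr1. Qed.

(** [deg] applied to [e^L = e^x e^y], divided by [e^L] on the right. *)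
Lemma bch_ode N :
  eqm N (\sum_(k < N.+1) (k.+1`!%:R)^-1 *: ad k bch (deg bch))
        (letter true + \sum_(k < N.+1) (k`!%:R)^-1 *: ad k (letter true) (letter false)).
Proof.
apply: (eqm_mulIr exp_letters_nil).
(* The factor [e^x e^y] on the left side becomes [e^L], so that the left side is the derivative
   [deg (e^L)]. *)
apply: eqm_trans (eqmM (eqm_refl _) (eqm_sym (exp_trunc_log exp_letters_nil))) _.
apply: eqm_trans (eqm_sym (deg_exp_trunc (@ord_ge_log _))) _.
apply: eqm_trans (eqm_deg (exp_trunc_log exp_letters_nil)) _.
(* The Leibniz rule gives [x e^x e^y + e^x y e^y]; in the second summand [e^x y] is replaced by
   [(e^{ad_x} y) e^x]. *)
rewrite degM !deg_exp_letter mulrDl -mulrA; apply: eqmD; first exact: eqm_refl.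
rewrite !mulrA; apply: eqmM => //.
apply: eqm_trans (eqmM (exp_letter_trunc _) (eqm_refl _)) _.
apply: eqm_trans (exp_truncM _ (@ord_ge_letter _)) _.
by apply: eqmM => //; apply: eqm_sym; apply: exp_letter_trunc.
Qed.

End NoncommutativeSeries.

(** * Dynkin's form in a Lie algebra *)

(** Jacobi is put in the form that bracketing with [br u v] is the commutator of bracketing with [u]
    and with [v]. *)
Record lie_bracket (K : numFieldType) (g : lmodType K) (br : g -> g -> g) : Prop := {
  lieDl : forall u v w, br (u + v) w = br u w + br v w;
  lieZl : forall c u w, br (c *: u) w = c *: br u w;
  lieN : forall u v, br u v = - br v u;
  lieJ : forall u v w, br (br u v) w = br u (br v w) - br v (br u w) }.

(** * Evaluating noncommutative series by brackets *)

Section LieEvaluation.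
Variables (K : numFieldType) (g : lmodType K) (br : g -> g -> g).
Hypothesis lie : lie_bracket br.
Variable X : bool -> g.
Implicit Types (p q : ncs K) (u v G : g) (n : nat).

Lemma lieDr u v w : br u (v + w) = br u v + br u w.
Proof. by rewrite lieN // lieDl // opprD -!lieN. Qed.
Lemma lieZr c u v : br u (c *: v) = c *: br u v.
Proof. by rewrite lieN // lieZl // -scalerN -lieN. Qed.
Lemma lie0r u : br u 0 = 0.
Proof. by rewrite -(scale0r (0 : g)) lieZr !scale0r. Qed.
Lemma lie0l u : br 0 u = 0.
Proof. by rewrite lieN // lie0r oppr0. Qed.
Lemma lieNr u v : br u (- v) = - br u v.
Proof. by rewrite -scaleN1r lieZr scaleN1r. Qed.
Lemma lieNl u v : br (- u) v = - br u v.
Proof. by rewrite -scaleN1r lieZl // scaleN1r. Qed.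
Lemma lie_sumr (I : Type) (s : seq I) (P : pred I) (F : I -> g) u :
  br u (\sum_(i <- s | P i) F i) = \sum_(i <- s | P i) br u (F i).
Proof. exact: (big_morph (br u) (lieDr u) (lie0r u)). Qed.
Lemma lie_suml (I : Type) (s : seq I) (P : pred I) (F : I -> g) u :
  br (\sum_(i <- s | P i) F i) u = \sum_(i <- s | P i) br (F i) u.
Proof. exact: (big_morph (br^~ u) (fun v w => lieDl lie v w u) (lie0l u)). Qed.

(** The part of [p] of degree [n], with each letter replaced by the operator of bracketing with its
    value, applied to [G]. *)
Fixpoint ev n p G : g :=
  if n is m.+1 then br (X true) (ev m (lquo true p) G) + br (X false) (ev m (lquo false p) G)
  else p [::] *: G.

(** Right-nested bracketing of the part of degree [n], without Dynkin's factor [1/n]. The recursion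
    stops at length one, where the innermost letter is itself the argument. *)
Fixpoint dynkin n p : g :=
  match n with
  | 0 => 0
  | 1 => p [:: true] *: X true + p [:: false] *: X false
  | m.+1 => br (X true) (dynkin m (lquo true p)) + br (X false) (dynkin m (lquo false p))
  end.

Lemma evS n p G : ev n.+1 p G =
  br (X true) (ev n (lquo true p) G) + br (X false) (ev n (lquo false p) G).
Proof. by []. Qed.

Lemma dynkinSS n p : dynkin n.+2 p =
  br (X true) (dynkin n.+1 (lquo true p)) + br (X false) (dynkin n.+1 (lquo false p)).
Proof. by []. Qed.

Lemma eq_ev n p q G : (forall w, size w = n -> p w = q w) -> ev n p G = ev n q G.
Proof.
elim: n p q => [|n IH] p q pq /=; first by rewrite pq.
by congr (br _ _ + br _ _); apply: IH => w wn /=; rewrite pq //= wn.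
Qed.

Lemma eq_dynkin n p q : (forall w, size w = n -> p w = q w) -> dynkin n p = dynkin n q.
Proof.
elim: n p q => [|[|n] IH] p q pq //; first by rewrite /= !pq.
have IH' b : dynkin n.+1 (lquo b p) = dynkin n.+1 (lquo b q).
  by apply: IH => w wn; rewrite /= pq //= wn.
by rewrite !dynkinSS !IH'.
Qed.

Lemma evDl n p q G : ev n (p + q) G = ev n p G + ev n q G.
Proof.
elim: n p q => [|n IH] p q; first by rewrite /= scalerDl.
by rewrite !evS !lquoD !IH !lieDr addrACA.
Qed.

Lemma evZl n c p G : ev n (c *: p) G = c *: ev n p G.
Proof.
elim: n p => [|n IH] p; first by rewrite /= scalerA.
by rewrite !evS !lquoZ !IH !lieZr scalerDr.
Qed.

Lemma evNl n p G : ev n (- p) G = - ev n p G.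
Proof. by rewrite -(scaleN1r p) evZl scaleN1r. Qed.

Lemma ev0l n G : ev n 0 G = 0.
Proof. by rewrite -(scale0r (0 : ncs K)) evZl scale0r. Qed.

Lemma ev_suml n (I : Type) (s : seq I) (P : pred I) (F : I -> ncs K) G :
  ev n (\sum_(i <- s | P i) F i) G = \sum_(i <- s | P i) ev n (F i) G.
Proof. exact: (big_morph (fun p => ev n p G) (fun p q => evDl n p q G) (ev0l n G)). Qed.

Lemma evDr n p u v : ev n p (u + v) = ev n p u + ev n p v.
Proof.
elim: n p => [|n IH] p /=; first by rewrite scalerDr.
by rewrite !IH !lieDr addrACA.
Qed.

Lemma evZr n c p u : ev n p (c *: u) = c *: ev n p u.
Proof.
elim: n p => [|n IH] p /=; first by rewrite !scalerA mulrC.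
by rewrite !IH !lieZr scalerDr.
Qed.

Lemma ev0r n p : ev n p 0 = 0.
Proof. by rewrite -(scale0r (0 : g)) evZr !scale0r. Qed.

Lemma ev_sumr n (I : Type) (s : seq I) (P : pred I) (F : I -> g) p :
  ev n p (\sum_(i <- s | P i) F i) = \sum_(i <- s | P i) ev n p (F i).
Proof. exact: (big_morph (ev n p) (evDr n p) (ev0r n p)). Qed.

Lemma dynkinD n p q : dynkin n (p + q) = dynkin n p + dynkin n q.
Proof.
elim: n p q => [|[|n] IH] p q; first by rewrite /= addr0.
  by rewrite /= !scalerDl addrACA.
by rewrite !dynkinSS !lquoD !IH !lieDr addrACA.
Qed.

Lemma dynkinZ n c p : dynkin n (c *: p) = c *: dynkin n p.
Proof.
elim: n p => [|[|n] IH] p; first by rewrite /= scaler0.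
  by rewrite /= -!scalerA scalerDr.
by rewrite !dynkinSS !lquoZ !IH !lieZr scalerDr.
Qed.

Lemma dynkinN n p : dynkin n (- p) = - dynkin n p.
Proof. by rewrite -(scaleN1r p) dynkinZ scaleN1r. Qed.

Lemma dynkin0 n : dynkin n 0 = 0.
Proof. by rewrite -(scale0r (0 : ncs K)) dynkinZ scale0r. Qed.

(** Concatenation of words is composition of operators; the sum runs over the degree taken from
    [p]. *)
Lemma evM n p q G : ev n (p * q) G = \sum_(i < n.+1) ev i p (ev (n - i) q G).
Proof.
elim: n p => [|n IH] p; first by rewrite big_ord1 /= scalerA.
rewrite evS !lquoM !evDl !evZl !IH !lieDr !lieZr !lie_sumr.
rewrite [RHS]big_ord_recl addrACA -scalerDr addrC; congr (_ + _).
by rewrite -big_split.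
Qed.

(** In a concatenation with a nonempty second word, the letters of the first act as operators on the
    nested bracket of the second. The empty word would leave nothing to act on, hence the condition
    on [q]. *)
Lemma dynkinM n p q : q [::] = 0 ->
  dynkin n (p * q) = \sum_(i < n.+1) ev i p (dynkin (n - i) q).
Proof.
move=> q0; elim: n p => [|[|n] IH] p; first by rewrite big_ord1 /= scaler0.
  rewrite big_ord_recl big_ord1 /= !scaler0 !lie0r !addr0 q0 !mulr0 !add0r.
  by rewrite scalerDr !scalerA.
rewrite dynkinSS !lquoM !dynkinD !dynkinZ !IH !lieDr !lieZr !lie_sumr.
rewrite [RHS]big_ord_recl addrACA -scalerDr addrC; congr (_ + _).
by rewrite -big_split.
Qed.

(** For [n > 0] this says that [ev n p] is the bracket with [dynkin n p / n]. *)
Definition lie_at n p := forall G, n%:R *: ev n p G = br (dynkin n p) G.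

Lemma eq_lie_at n p q : (forall w, size w = n -> p w = q w) -> lie_at n q -> lie_at n p.
Proof. by move=> pq lq G; rewrite (eq_ev _ pq) (eq_dynkin pq). Qed.

Lemma lie_atD n p q : lie_at n p -> lie_at n q -> lie_at n (p + q).
Proof. by move=> lp lq G; rewrite evDl dynkinD lieDl // scalerDr lp lq. Qed.

Lemma lie_atZ n c p : lie_at n p -> lie_at n (c *: p).
Proof. by move=> lp G; rewrite evZl dynkinZ lieZl // -lp !scalerA mulrC. Qed.

Lemma lie_atB n p q : lie_at n p -> lie_at n q -> lie_at n (p - q).
Proof. by move=> lp lq; apply: lie_atD => //; rewrite -scaleN1r; apply: lie_atZ. Qed.

Lemma lie_at0 n : lie_at n 0.
Proof. by move=> G; rewrite ev0l dynkin0 lie0l scaler0. Qed.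

Lemma lie_at_sum n (I : Type) (s : seq I) (P : pred I) (F : I -> ncs K) :
  (forall i, P i -> lie_at n (F i)) -> lie_at n (\sum_(i <- s | P i) F i).
Proof. by move=> lF; elim/big_rec: _ => [|i p Pi lp]; [apply: lie_at0|apply: lie_atD => //; apply: lF]. Qed.

Lemma lie_at_letter n b : lie_at n (letter K b).
Proof.
case: n => [|[|n]] G; first by rewrite scale0r lie0l.
  by case: b; rewrite /= ?scale1r ?scale0r ?lie0r ?addr0 ?add0r.
have l0 w : size w = n.+2 -> letter K b w = (0 : ncs K) w by case: w => [|c [|c' w]] //= _; rewrite eqseq_cons andbF.
by rewrite (eq_ev _ l0) (eq_dynkin l0); apply: lie_at0.
Qed.

Lemma lie_at_deg n p : lie_at n p -> lie_at n (deg p).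
Proof.
by move=> lp; apply: (@eq_lie_at _ _ (n%:R *: p)) => [w <- //|]; apply: lie_atZ.
Qed.

(** In degree [n > 0] the derivation is multiplication by the invertible scalar [n]; in degree 0
    both sides of [lie_at] vanish. *)
Lemma lie_at_deg_inv n p : lie_at n (deg p) -> lie_at n p.
Proof.
case: n => [|n]; first by move=> _ G; rewrite scale0r lie0l.
move=> lp; apply: (@eq_lie_at _ _ (n.+1%:R^-1 *: deg p)); last exact: lie_atZ.
by move=> w wn; rewrite /= wn mulrA mulVf ?mul1r // pnatr_eq0.
Qed.

(** After division by the degrees, [p] and [q] act as brackets with [d] and [e]. The nested
    bracketings combine to [j [d,e] - i [e,d] = (i + j) [d,e]], and Jacobi identifies its bracket
    with the commutator of operators. *)
Lemma lie_at_commutator_term i j p q G : (0 < i)%N -> (0 < j)%N ->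
    lie_at i p -> lie_at j q ->
  (i + j)%:R *: (ev i p (ev j q G) - ev j q (ev i p G)) =
  br (ev i p (dynkin j q) - ev j q (dynkin i p)) G.
Proof.
move=> i0 j0 lp lq.
have ni n : (0 < n)%N -> n%:R != 0 :> K by rewrite pnatr_eq0 -lt0n.
pose d := i%:R^-1 *: dynkin i p; pose e := j%:R^-1 *: dynkin j q.
have evp v : ev i p v = br d v by rewrite lieZl // -lp scalerA mulVf ?scale1r ?ni.
have evq v : ev j q v = br e v by rewrite lieZl // -lq scalerA mulVf ?scale1r ?ni.
have -> : dynkin i p = i%:R *: d by rewrite scalerA mulfV ?scale1r ?ni.
have -> : dynkin j q = j%:R *: e by rewrite scalerA mulfV ?scale1r ?ni.
clearbody d e; rewrite !evp !evq !lieZr (lieN lie e d) scalerN opprK -scalerDl lieZl // lieJ //.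
by rewrite -natrD addnC.
Qed.

(** Neither factor has a constant term, so a product of degree at most [N + 1] only involves degrees
    at most [N]. This gain of one degree drives the induction for [bch]. *)
Lemma lie_at_commutator N p q : p [::] = 0 -> q [::] = 0 ->
    (forall n, (n <= N)%N -> lie_at n p) -> (forall n, (n <= N)%N -> lie_at n q) ->
  forall n, (n <= N.+1)%N -> lie_at n (commutator p q).
Proof.
move=> p0 q0 lp lq n nN G; rewrite /commutator.
have rev (F : nat -> nat -> g) :
    \sum_(i < n.+1) F i (n - i)%N = \sum_(i < n.+1) F (n - i)%N i.
  rewrite (reindex_inj rev_ord_inj) /=; apply: eq_bigr => i _.
  by rewrite subSS subKn // -ltnS.
rewrite evDl evNl dynkinD dynkinN !evM !dynkinM //.
rewrite (rev (fun i j => ev i q (ev j p G))) (rev (fun i j => ev i q (dynkin j p))).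
rewrite -!sumrB scaler_sumr lie_suml; apply: eq_bigr => -[i /= iN] _.
have ni : (i + (n - i) = n)%N by rewrite subnKC // -ltnS.
case: (posnP i) => [->|i0].
  by rewrite /= p0 !scale0r ev0r subr0 scaler0 lie0l.
case: (posnP (n - i)) => [->|ni0].
  by rewrite /= q0 !scale0r ev0r subr0 scaler0 lie0l.
rewrite -{1}ni; apply: lie_at_commutator_term => //; [apply: lp|apply: lq].
  by rewrite -ltnS; apply: leq_trans nN; rewrite -subn_gt0.
by rewrite leq_subLR (leq_trans nN) // -add1n leq_add2r.
Qed.

Lemma ad_nil k (p q : ncs K) : p [::] = 0 -> q [::] = 0 -> ad k p q [::] = 0.
Proof.
move=> p0 q0; apply: (@ord_ge_ad _ 1 p q k) => //; first by case.
  by case.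
by rewrite addn1.
Qed.

Lemma lie_at_bch n : lie_at n (bch K).
Proof.
suff main N : forall n, (n <= N)%N -> lie_at n (bch K) by apply: (main n).
elim: N => [|N IH] {}n nN.
  by move: nN; rewrite leqn0 => /eqP -> G; rewrite scale0r lie0l.
have bch0 : bch K [::] = 0 by apply: ord_ge_log.
have deg0 : deg (bch K) [::] = 0 by apply: ord_ge_deg.
have lad k m : (m <= N)%N -> lie_at m (ad k (bch K) (deg (bch K))).
  elim: k m => [|k IHk] m mN; first by apply: lie_at_deg; apply: IH.
  by apply: (@lie_at_commutator N); rewrite ?ad_nil // ltnW.
have ladS k : lie_at n (ad k.+1 (bch K) (deg (bch K))).
  by apply: (@lie_at_commutator N); rewrite ?ad_nil // => m; apply: lad.
have lxy k m : lie_at m (ad k (letter K true) (letter K false)).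
  elim: k m => [|k IHk] m; first exact: lie_at_letter.
  by apply: (@lie_at_commutator m); rewrite ?ad_nil // => i im; apply: lie_at_letter.
(* The equation [bch_ode] is solved for its summand [k = 0], which is [deg L]; every other summand
   is a letter or an iterated commutator already known to be in the class. *)
apply: lie_at_deg_inv.
apply: (@eq_lie_at _ _ (letter K true
    + \sum_(k < N.+2) (k`!%:R)^-1 *: ad k (letter K true) (letter K false)
    - \sum_(k < N.+1) (k.+2`!%:R)^-1 *: ad k.+1 (bch K) (deg (bch K)))); last first.
  apply: lie_atB; first apply: lie_atD; first exact: lie_at_letter.
    by apply: lie_at_sum => k _; apply: lie_atZ.
  by apply: lie_at_sum => k _; apply: lie_atZ.
move=> w wn; have := @bch_ode K N.+1 w; rewrite wn => /(_ nN).
rewrite big_ord_recl => eqw; rewrite ncs_coefB -eqw ncs_coefD addrK.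
by rewrite ncs_coefZ (_ : (_.+1)`! = 1%N) ?invr1 ?mul1r.
Qed.

End LieEvaluation.

(** The abstract counterpart of the order in epsilon: [fil n] stands for having order at least
    [n]. *)
Record lie_filtration (K : numFieldType) (g : lmodType K) (br : g -> g -> g)
    (fil : nat -> g -> Prop) : Prop := {
  fil_leq : forall m n u, (m <= n)%N -> fil n u -> fil m u;
  fil_0 : forall n, fil n 0;
  filD : forall n u v, fil n u -> fil n v -> fil n (u + v);
  filZ : forall n c u, fil n u -> fil n (c *: u);
  fil_br : forall m n u v, fil m u -> fil n v -> fil (m + n) (br u v) }.

(** * Exponentials and the Baker-Campbell-Hausdorff theorem in a filtered Lie algebra *)

Section FilteredExponential.
Variables (K : numFieldType) (g : lmodType K) (br : g -> g -> g).
Hypothesis lie : lie_bracket br.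
Variable fil : nat -> g -> Prop.
Hypothesis filt : lie_filtration br fil.
Hypothesis fil0_all : forall u, fil 0 u.
Implicit Types (u v G : g) (n M : nat).

Definition eqf M u v := fil M.+1 (u - v).

Lemma filN n u : fil n u -> fil n (- u).
Proof. by rewrite -scaleN1r; apply: (filZ filt). Qed.

Lemma fil_sum n (I : Type) (s : seq I) (P : pred I) (F : I -> g) :
  (forall i, P i -> fil n (F i)) -> fil n (\sum_(i <- s | P i) F i).
Proof.
by move=> FP; elim/big_rec: _ => [|i u Pi]; [exact: (fil_0 filt)|apply: (filD filt); exact: FP].
Qed.

Lemma eqf_refl M u : eqf M u u.
Proof. by rewrite /eqf subrr; apply: (fil_0 filt). Qed.

Lemma eqf_sym M u v : eqf M u v -> eqf M v u.
Proof. by move=> uv; rewrite /eqf -opprB; apply: filN. Qed.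

Lemma eqf_trans M u v w : eqf M u v -> eqf M v w -> eqf M u w.
Proof. by move=> uv vw; rewrite /eqf -(subrK v u) -addrA; apply: (filD filt). Qed.

Lemma eqfZ M c u v : eqf M u v -> eqf M (c *: u) (c *: v).
Proof. by move=> uv; rewrite /eqf -scalerBr; apply: (filZ filt). Qed.

Lemma eqf_sum M (I : Type) (s : seq I) (P : pred I) (F F' : I -> g) :
  (forall i, P i -> eqf M (F i) (F' i)) ->
  eqf M (\sum_(i <- s | P i) F i) (\sum_(i <- s | P i) F' i).
Proof. by move=> FF; rewrite /eqf -sumrB; apply: fil_sum. Qed.

Lemma eqf_br M u v u' v' : eqf M u u' -> eqf M v v' -> eqf M (br u v) (br u' v').
Proof.
move=> uu vv; rewrite /eqf.
have -> : br u v - br u' v' = br (u - u') v + br u' (v - v').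
  by rewrite (lieDl lie) (lieNl lie) (lieDr lie) (lieNr lie) addrA subrK.
apply: (filD filt); last exact: (fil_br filt (fil0_all u') vv).
by rewrite -[M.+1]addn0; apply: (fil_br filt uu (fil0_all v)).
Qed.

Lemma eqf_sum_square M (F : nat -> nat -> g) :
    (forall i j, fil (i + j) (F i j)) ->
  eqf M (\sum_(i < M.+1) \sum_(j < M.+1) F i j)
        (\sum_(n < M.+1) \sum_(i < n.+1) F i (n - i)%N).
Proof.
move=> Ffil; pose F' i j := if (i + j <= M)%N then F i j else 0.
have -> : \sum_(n < M.+1) \sum_(i < n.+1) F i (n - i)%N
        = \sum_(n < M.+1) \sum_(i < n.+1) F' i (n - i)%N.
  apply: eq_bigr => n _; apply: eq_bigr => i _.
  by rewrite /F' subnKC -ltnS ?ltn_ord // ltnS -ltnS ltn_ord.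
rewrite -sum_square => [|i j]; last by rewrite /F' ltnNge => /negPf ->.
apply: eqf_sum => i _; apply: eqf_sum => j _; rewrite /F'.
case: leqP => [_|Mij]; first exact: eqf_refl.
by rewrite /eqf subr0; apply: (fil_leq filt Mij).
Qed.

Definition lie_exp M u G := \sum_(k < M.+1) (k`!%:R)^-1 *: iter k (br u) G.

Lemma fil_iter u k n G : fil 1 u -> fil n G -> fil (k + n) (iter k (br u) G).
Proof.
move=> u1 Gn; elim: k => [|k IH] //=.
by rewrite addSn -add1n; apply: (fil_br filt u1).
Qed.

Lemma eqf_iter M k u v G G' : eqf M u v -> eqf M G G' ->
  eqf M (iter k (br u) G) (iter k (br v) G').
Proof. by move=> uv GG; elim: k => //= k IH; apply: eqf_br. Qed.

Lemma eqf_lie_exp M u v G G' : eqf M u v -> eqf M G G' ->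
  eqf M (lie_exp M u G) (lie_exp M v G').
Proof. by move=> uv GG; apply: eqf_sum => k _; apply/eqfZ/eqf_iter. Qed.

Lemma iter_brZr k u c G : iter k (br u) (c *: G) = c *: iter k (br u) G.
Proof. by elim: k => //= k ->; rewrite (lieZr lie). Qed.

Lemma iter_br_sum k u (I : Type) (s : seq I) (P : pred I) (F : I -> g) :
  iter k (br u) (\sum_(i <- s | P i) F i) = \sum_(i <- s | P i) iter k (br u) (F i).
Proof. by elim: k => //= k ->; rewrite (lie_sumr lie). Qed.

Lemma iter_brNl k u G : iter k (br (- u)) G = (-1) ^+ k *: iter k (br u) G.
Proof.
elim: k => [|k IH] /=; first by rewrite scale1r.
by rewrite IH (lieZr lie) (lieNl lie) scalerN -scaleNr exprS mulN1r.
Qed.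

(** Along the antidiagonal [m] the coefficients add up to [(1 - 1)^m / m!], so only [m = 0]
    survives. *)
Lemma lie_expNK M u G : fil 1 u -> eqf M (lie_exp M u (lie_exp M (- u) G)) G.
Proof.
move=> u1; rewrite /lie_exp.
pose F i j := ((i`!%:R)^-1 * (j`!%:R)^-1 * (-1) ^+ j) *: iter (i + j) (br u) G.
have -> : \sum_(k < M.+1) k`!%:R^-1 *:
     iter k (br u) (\sum_(l < M.+1) l`!%:R^-1 *: iter l (br (- u)) G)
   = \sum_(k < M.+1) \sum_(l < M.+1) F k l.
  apply: eq_bigr => k _; rewrite iter_br_sum scaler_sumr; apply: eq_bigr => l _.
  by rewrite iter_brNl scalerA iter_brZr scalerA mulrA -iterD.
apply: eqf_trans; first apply: eqf_sum_square => i j.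
  apply: (filZ filt); rewrite -[X in fil X]addn0.
  exact: fil_iter u1 (fil0_all G).
rewrite big_ord_recl big_ord1 /F /= !invr1 !mulr1 scale1r big1 ?addr0; first exact: eqf_refl.
move=> n _; set m := lift ord0 n.
have -> : \sum_(i < m.+1) F i (m - i)%N
    = ((m`!%:R)^-1 * (1 - 1) ^+ m) *: iter m (br u) G.
  rewrite [(1 - 1) ^+ _]exprDn mulr_sumr scaler_suml (reindex_inj rev_ord_inj) /=.
  apply: eq_bigr => i _; rewrite subSS /F.
  have im : (i <= m)%N by rewrite -ltnS.
  rewrite subKn // subnK //; congr (_ *: _).
  rewrite expr1n mul1r -[(-1) ^+ i *+ _]mulr_natl mulrA bin_fact_inv //.
  by rewrite [_ * (i`!%:R)^-1]mulrC.
by rewrite subrr expr0n mulr0 scale0r.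
Qed.

Variable X : bool -> g.
Hypothesis X1 : forall b, fil 1 (X b).

Notation ev := (ev br X).
Notation dynkin := (dynkin br X).

Lemma fil_ev n p m G : fil m G -> fil (n + m) (ev n p G).
Proof.
move=> Gm; elim: n p => [|n IH] p; first exact: (filZ filt).
by rewrite evS addSn -add1n; apply: (filD filt); apply: (fil_br filt (X1 _)).
Qed.

Lemma fil_dynkin n p : fil n (dynkin n p).
Proof.
elim: n p => [|[|n] IH] p; first exact: fil0_all.
  by apply: (filD filt); apply: (filZ filt).
by rewrite dynkinSS -add1n; apply: (filD filt); apply: (fil_br filt (X1 _)).
Qed.

Definition ev_upto M p G := \sum_(n < M.+1) ev n p G.

Lemma eqf_ev_upto M p u v : eqf M u v -> eqf M (ev_upto M p u) (ev_upto M p v).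
Proof.
move=> uv; apply: eqf_sum => n _; rewrite /eqf.
have -> : ev n p u - ev n p v = ev n p (u - v).
  by rewrite (evDr lie) -(scaleN1r v) (evZr lie) scaleN1r.
by apply: (fil_leq filt (leq_addl n _)); apply: fil_ev.
Qed.

Lemma eq_ev_upto M p q G : eqm M p q -> ev_upto M p G = ev_upto M q G.
Proof.
move=> pq; apply: eq_bigr => n _; apply: eq_ev => w wn; apply: pq.
by rewrite wn -ltnS.
Qed.

(** A word of length [n] raises the filtration by [n], so the products lost by truncating both
    factors are invisible up to level [M]. *)
Lemma ev_uptoM M p q G : eqf M (ev_upto M p (ev_upto M q G)) (ev_upto M (p * q) G).
Proof.
rewrite /ev_upto.
under eq_bigr => n _ do rewrite (ev_sumr lie).
under [in X in eqf _ _ X]eq_bigr => n _ do rewrite (evM lie).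
apply: (@eqf_sum_square M (fun i j => ev i p (ev j q G))) => i j.
by rewrite -[X in fil X]addn0 -addnA; do 2!apply: fil_ev; apply: fil0_all.
Qed.

Lemma ev_upto_exp M p G :
  ev_upto M (exp_trunc M p) G = \sum_(k < M.+1) (k`!%:R)^-1 *: ev_upto M (p ^+ k) G.
Proof.
rewrite /ev_upto /exp_trunc; under eq_bigr => n _ do rewrite (ev_suml lie).
rewrite exchange_big; apply: eq_bigr => k _ /=; rewrite scaler_sumr.
by apply: eq_bigr => n _; rewrite (evZl lie).
Qed.

Lemma ev_letterX b k n G :
  ev n (letter K b ^+ k) G = if n == k then iter k (br (X b)) G else 0.
Proof.
elim: k n => [|k IH] [|n].
- by rewrite /= scale1r.
- have l0 w : size w = n.+1 -> (1 : ncs K) w = (0 : ncs K) w by case: w.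
  by rewrite expr0 (eq_ev _ _ _ l0) (ev0l lie).
- by rewrite exprS /= mul0r scale0r.
have lq c : lquo c (letter K b ^+ k.+1) = (c == b)%:R *: letter K b ^+ k.
  by rewrite exprS lquoM lquo_letter -scalerAl mul1r scale0r addr0.
rewrite evS !lq !(evZl lie) !IH eqSS.
case: b {IH lq} => /=; rewrite !scale1r !scale0r (lie0r lie) ?addr0 ?add0r;
by case: (n == k); rewrite ?(lie0r lie).
Qed.

Lemma ev_upto_exp_letter M b G : ev_upto M (exp_letter K b) G = lie_exp M (X b) G.
Proof.
rewrite (eq_ev_upto _ (@exp_letter_trunc K M b)) ev_upto_exp; apply: eq_bigr => k _.
congr (_ *: _); rewrite /ev_upto (bigD1 k) //= ev_letterX eqxx big1 ?addr0 //.
by move=> n; rewrite -val_eqE /= => /negPf nk; rewrite ev_letterX nk.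
Qed.

(** The term [n = 0] vanishes, since [dynkin 0 p = 0]. *)
Definition lie_bch M := \sum_(n < M.+1) (n%:R)^-1 *: dynkin n (bch K).

(** Here [lie_at_bch] is divided by the degree: bracketing with the Dynkin series is the same
    operator as [log (e^x e^y)] evaluated at the two brackets. *)
Lemma br_lie_bch M G : br (lie_bch M) G = ev_upto M (bch K) G.
Proof.
rewrite /lie_bch (lie_suml lie); apply: eq_bigr => -[[|n] nM] _; rewrite [nat_of_ord _]/=.
  by rewrite (lieZl lie) (lie0l lie) scaler0 /= /log_trunc big_ord0 scale0r.
by rewrite (lieZl lie) -(lie_at_bch lie X) scalerA mulVf ?scale1r // pnatr_eq0.
Qed.

(** Evaluation is multiplicative up to level [M], so it carries [e^L = e^x e^y] from noncommutative
    series to operators. *)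
Lemma lie_exp_bch M G :
  eqf M (lie_exp M (lie_bch M) G) (lie_exp M (X true) (lie_exp M (X false) G)).
Proof.
rewrite -!ev_upto_exp_letter.
apply: eqf_trans (eqf_sym (ev_uptoM _ _ _ _)).
rewrite -(eq_ev_upto _ (exp_trunc_log (exp_letters_nil K))) ev_upto_exp.
apply: eqf_sum => k _; apply: eqfZ; elim: (k : nat) => [|j IH].
  rewrite /= expr0 /ev_upto big_ord_recl big1 /= ?scale1r ?addr0; first exact: eqf_refl.
  move=> n _; have := ev_letterX true 0 n.+1 G; rewrite expr0; exact.
rewrite iterS br_lie_bch exprS; apply: eqf_trans (ev_uptoM _ _ _ _).
exact: eqf_ev_upto.
Qed.

End FilteredExponential.

(** * Formal series of smooth functions *)

Lemma sum_nE (F : nat -> R) n : sum_n F n = \sum_(i < n.+1) F i.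
Proof.
elim: n => [|n IH]; first by rewrite sum_O big_ord1.
by rewrite sum_Sn IH [in RHS]big_ord_recr.
Qed.

Lemma sum_n_m1E (F : nat -> R) n : sum_n_m F 1 n = \sum_(i < n) F i.+1.
Proof.
elim: n => [|n IH]; first by rewrite sum_n_m_zero ?big_ord0 //; apply/ssrnat.ltP.
have n1 : (1 <= n.+1)%coq_nat by apply/ssrnat.leP.
by rewrite sum_n_Sm // IH [in RHS]big_ord_recr.
Qed.

Lemma ncoefK (p : ncs R) : NCS p = p. Proof. by case: p. Qed.

(** The sum over all splittings of a word obeys the recursion defining the product of [ncs]: the
    empty prefix is the summand split off. *)
Lemma nc_mulE (p q : ncseries) : nc_mul p q = ncoef (NCS p * NCS q).
Proof.
apply/funext => w; rewrite /nc_mul sum_nE.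
elim: w p => [|b w IH] p; first by rewrite big_ord1.
rewrite ncs_coefM_cons -[lquo b _]/(NCS (fun v => p (b :: v))) -IH.
by rewrite big_ord_recl /= addrC.
Qed.

Lemma nc_exp_letterE b : nc_exp_letter b = ncoef (exp_letter R b).
Proof.
apply/funext => w; rewrite /nc_exp_letter /= INRE factE RinvE.
have -> : List.forallb (Bool.eqb b) w = all (pred1 b) w.
  by elim: w => //= c w ->; case: b c => [] [].
by [].
Qed.

Lemma nc_oneE : nc_one = ncoef (1 : ncs R).
Proof. by apply/funext => -[|b w]. Qed.

Lemma nc_logE (p : ncs R) : nc_log p = ncoef (ncs_log p).
Proof.
apply/funext => w; rewrite /nc_log sum_n_m1E -[RHS]/((log_trunc (size w) (p - 1) : ncs R) w) /log_trunc ncs_coef_sum.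
apply: eq_bigr => k _; rewrite ncs_coefZ RpowE INRE RdivE minusE subn1.
rewrite -[RHS]/(_ * _); congr (_ * _).
have -> : (fun v => Rminus (p v) (nc_one v)) = ncoef (p - 1).
  by apply/funext => v; rewrite nc_oneE.
move: {k} (k.+1) => n; elim: n w => [|n IH] w; first by rewrite nc_oneE.
have {}IH : Nat.iter n (nc_mul (p - 1)) nc_one = ncoef ((p - 1) ^+ n).
  exact/funext.
transitivity (nc_mul (p - 1) (Nat.iter n (nc_mul (p - 1)) nc_one) w) => //.
by rewrite IH nc_mulE !ncoefK exprS.
Qed.

Lemma bch_coeffE : bch_coeff = ncoef (bch R).
Proof.
by rewrite /bch_coeff !nc_exp_letterE nc_mulE nc_logE !ncoefK.
Qed.

(** Smoothness is bundled with the series because the Lie axioms are proved for smooth functions;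
    periodicity is not bundled, to keep the coordinate functions. *)
Record smooth_series := Sser { terms :> nat -> fn; smooth_terms : forall m, smooth (terms m) }.

HB.instance Definition _ := gen_eqMixin smooth_series.
HB.instance Definition _ := gen_choiceMixin smooth_series.

Lemma smooth_seriesP (u v : smooth_series) : (forall m A phi, u m A phi = v m A phi) -> u = v.
Proof.
case: u v => [u su] [v sv] /= uv.
have {}uv : u = v by apply/funext => m; apply: fn_ext; apply: uv.
by case: v / uv sv => sv; congr Sser; apply: Prop_irrelevance.
Qed.

Definition smooth_series_add (u v : smooth_series) : smooth_series :=
  @Sser (sadd u v) (fun m => smooth_add _ _ (smooth_terms u m) (smooth_terms v m)).
Definition smooth_series_opp (u : smooth_series) : smooth_series :=
  @Sser (sopp u) (fun m => smooth_opp _ (smooth_terms u m)).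
Definition smooth_series_zero : smooth_series := @Sser szero (fun=> smooth_const 0).
Definition smooth_series_scale (c : R) (u : smooth_series) : smooth_series :=
  @Sser (fun m => fscal c (u m)) (fun m => smooth_scal c _ (smooth_terms u m)).

Lemma smooth_series_addA : associative smooth_series_add.
Proof. by move=> u v w; apply: smooth_seriesP => m A phi; apply: addrA. Qed.
Lemma smooth_series_addC : commutative smooth_series_add.
Proof. by move=> u v; apply: smooth_seriesP => m A phi; apply: addrC. Qed.
Lemma smooth_series_add0 : left_id smooth_series_zero smooth_series_add.
Proof. by move=> u; apply: smooth_seriesP => m A phi; apply: add0r. Qed.
Lemma smooth_series_addN : left_inverse smooth_series_zero smooth_series_opp smooth_series_add.
Proof. by move=> u; apply: smooth_seriesP => m A phi; apply: addNr. Qed.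

HB.instance Definition _ :=
  GRing.isZmodule.Build smooth_series smooth_series_addA smooth_series_addC smooth_series_add0 smooth_series_addN.

Lemma smooth_series_scaleA c d u : smooth_series_scale c (smooth_series_scale d u) = smooth_series_scale (c * d) u.
Proof. by apply: smooth_seriesP => m A phi; apply: mulrA. Qed.
Lemma smooth_series_scale1 : left_id 1 smooth_series_scale.
Proof. by move=> u; apply: smooth_seriesP => m A phi; apply: mul1r. Qed.
Lemma smooth_series_scaleDr : right_distributive smooth_series_scale +%R.
Proof. by move=> c u v; apply: smooth_seriesP => m A phi; apply: mulrDr. Qed.
Lemma smooth_series_scaleDl u : {morph smooth_series_scale^~ u : c d / c + d}.
Proof. by move=> c d; apply: smooth_seriesP => m A phi; apply: mulrDl. Qed.

HB.instance Definition _ := GRing.Zmodule_isLmodule.Build R smooth_series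
  smooth_series_scaleA smooth_series_scale1 smooth_series_scaleDr smooth_series_scaleDl.

Implicit Types u v w : smooth_series.

Lemma termsDE u v m A phi : (u + v) m A phi = u m A phi + v m A phi. Proof. by []. Qed.
Lemma termsBE u v m A phi : (u - v) m A phi = u m A phi - v m A phi. Proof. by []. Qed.
Lemma termsZE c u m A phi : (c *: u) m A phi = c * u m A phi. Proof. by []. Qed.
Lemma terms_sum (I : Type) (s : seq I) (P : pred I) (F : I -> smooth_series) m A phi :
  (\sum_(i <- s | P i) F i) m A phi = \sum_(i <- s | P i) F i m A phi.
Proof.
by elim/big_rec2: _ => // i x y _ <-.
Qed.

(** * The filtered Lie algebra of smooth series *)

Definition series_bracket u v : smooth_series :=
  @Sser (spoisson u v) (fun m => @fn_class_spoisson _ u v m smooth_class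
    (fun i j => smooth_poisson _ _ (smooth_terms u i) (smooth_terms v j))).

Lemma series_bracketE u v m A phi :
  series_bracket u v m A phi = \sum_(i < m.+1) poisson (u i) (v (m - i)%N) A phi.
Proof. by rewrite /= /spoisson sum_nE. Qed.

Lemma poisson_bracketl u v n W A phi :
  poisson (series_bracket u v n) W A phi =
  \sum_(i < n.+1) poisson (poisson (u i) (v (n - i)%N)) W A phi.
Proof.
rewrite -(sum_nE (fun i => poisson (poisson (u i) (v (n - i)%N)) W A phi)).
rewrite -(poisson_sum_n (fun i => poisson (u i) (v (n - i)%N))) // => i.
by apply: smooth_poisson; apply: smooth_terms.
Qed.

Lemma poisson_bracketr u v n W A phi :
  poisson W (series_bracket u v n) A phi =
  \sum_(i < n.+1) poisson W (poisson (u i) (v (n - i)%N)) A phi.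
Proof.
rewrite poisson_antisym /fopp poisson_bracketl RoppE -sumrN; apply: eq_bigr => i _.
by rewrite [in RHS]poisson_antisym.
Qed.

Lemma series_bracket_lie : lie_bracket series_bracket.
Proof.
split=> [u v w|c u w|u v|u v w]; apply: smooth_seriesP => m A phi.
- rewrite termsDE !series_bracketE -big_split; apply: eq_bigr => i _ /=.
  by rewrite poisson_addl //; apply: smooth_terms.
- rewrite termsZE !series_bracketE mulr_sumr; apply: eq_bigr => i _ /=.
  by rewrite poisson_scall.
- rewrite -[RHS]/(- (series_bracket v u m A phi)) !series_bracketE -sumrN.
  rewrite (reindex_inj rev_ord_inj); apply: eq_bigr => i _ /=.
  rewrite poisson_antisym subSS subKn //.
  by rewrite -ltnS.
rewrite termsBE !series_bracketE.
(* All three double sums are indexed by the degrees [i] in [u] and [j] in [v], with the rest of the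
   degree in [w]; then the Jacobi identity applies termwise. *)
pose F i j := poisson (poisson (u i) (v j)) (w (m - (i + j))%N) A phi.
have -> : \sum_(n < m.+1) poisson (series_bracket u v n) (w (m - n)%N) A phi
        = \sum_(n < m.+1) \sum_(i < n.+1) F i (n - i)%N.
  apply: eq_bigr => n _; rewrite poisson_bracketl; apply: eq_bigr => i _.
  by rewrite /F subnKC // -ltnS.
pose G i j := poisson (v j) (poisson (u i) (w (m - (i + j))%N)) A phi.
have -> : \sum_(j < m.+1) poisson (v j) (series_bracket u w (m - j)%N) A phi
        = \sum_(j < m.+1) \sum_(i < (m - j).+1) G i j.
  apply: eq_bigr => j _; rewrite poisson_bracketr; apply: eq_bigr => i _.
  by rewrite /G addnC subnDA.
rewrite sum_antidiagonals -sum_triangle_exchange -sumrB; apply: eq_bigr => i _.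
rewrite poisson_bracketr -sumrB; apply: eq_bigr => j _; rewrite /F /G -subnDA.
by rewrite poisson_jacobi; try apply: smooth_terms.
Qed.

Definition series_order n u := forall m, (m < n)%N -> terms u m = fzero.

Lemma poisson0l U : poisson fzero U = fzero.
Proof.
apply: fn_ext => A phi; rewrite /poisson (dA_const 0 : dA fzero = _).
by rewrite (dphi_const 0 : dphi fzero = _) /fconst !Rmult_0_l Rminus_0_r.
Qed.

Lemma poisson0r U : poisson U fzero = fzero.
Proof.
by rewrite poisson_antisym poisson0l; apply: fn_ext => A phi; apply: oppr0.
Qed.

Lemma series_filtration : lie_filtration series_bracket series_order.
Proof.
split=> [m n u mn un|n|n u v un vn|n c u un|a b u v ua vb] k kn.
- by apply: un; apply: leq_trans mn.
- by [].
- by apply: fn_ext => A phi; rewrite termsDE un // vn // -[LHS]/(0 + 0) addr0.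
- by apply: fn_ext => A phi; rewrite termsZE un // -[LHS]/(_ * 0) mulr0.
apply: fn_ext => A phi; rewrite series_bracketE big1 // => i _.
case: (ltnP i a) => [ia|ai]; first by rewrite ua ?poisson0l.
rewrite vb ?poisson0r // ltn_subLR -1?ltnS //.
by apply: leq_trans kn _; rewrite leq_add2r.
Qed.

Lemma series_order0 u : series_order 0 u. Proof. by []. Qed.

Local Notation eqs := (eqf series_order).

Lemma eqfP M u v : eqs M u v <-> forall m, (m <= M)%N -> terms u m = terms v m.
Proof.
split=> uv m mM; apply: fn_ext => A phi; last first.
  by rewrite termsBE uv // subrr.
by apply/eqP; rewrite -subr_eq0 -termsBE uv.
Qed.

(** The passage from truncated statements to exact ones. *)
Lemma smooth_series_eqf u v : (forall M, eqs M u v) -> u = v.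
Proof. by move=> uv; apply: smooth_seriesP => m A phi; rewrite (proj1 (eqfP m u v) (uv m) m). Qed.

(** The coefficient of degree [m] is read off the truncation at [m]; when [u] has order at least
    one, [eqf_series_exp] shows that later truncations do not change it. *)
Definition series_exp u (G : smooth_series) : smooth_series := @Sser (fun m => lie_exp series_bracket m u G m)
  (fun m => smooth_terms _ m).

Lemma exp_seriesE u (G : smooth_series) : exp_series u G = terms (series_exp u G).
Proof.
apply/funext => m; apply: fn_ext => A phi; rewrite /exp_series sum_nE /=.
rewrite terms_sum; apply: eq_bigr => k _; rewrite termsZE INRE factE RdivE mulrC.
congr (_ * _); move: {k} (k : nat) => k; elim: k m A phi => // n IH m A phi.
have -> : Nat.iter n.+1 (spoisson u) G = terms (iter n.+1 (series_bracket u) G) => //.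
rewrite /=; congr spoisson; apply/funext => i; apply: fn_ext => a p; exact: IH.
Qed.

Lemma eqf_series_exp M u (G : smooth_series) : series_order 1 u -> eqs M (series_exp u G) (lie_exp series_bracket M u G).
Proof.
move=> u1; apply/eqfP => m mM; apply: fn_ext => A phi; rewrite /= !terms_sum.
rewrite [LHS](big_ord_widen M.+1
  (fun k => ((k`!%:R)^-1 *: iter k (series_bracket u) G) m A phi)) // big_mkcond.
apply: eq_bigr => k _; case: ifP => // /negbT; rewrite -leqNgt => mk.
rewrite termsZE (_ : terms _ m = fzero) ?mulr0 //.
by apply: (fil_iter series_filtration k u1 (series_order0 G)); rewrite addn0.
Qed.

Lemma series_expNK u (G : smooth_series) : series_order 1 u -> series_exp u (series_exp (- u) G) = G.
Proof.
move=> u1; apply: smooth_series_eqf => M.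
have Nu1 := filN series_filtration u1.
refine (eqf_trans series_filtration (eqf_series_exp _ u1) _).
refine (eqf_trans series_filtration _ (lie_expNK series_bracket_lie series_filtration series_order0 M G u1)).
apply: (eqf_lie_exp series_bracket_lie series_filtration series_order0); first exact: (eqf_refl series_filtration).
exact: eqf_series_exp.
Qed.

Definition letters u w (b : bool) := if b then u else w.

(** The same diagonal reading as for [series_exp], justified by [eqf_series_boxplus]. *)
Definition series_boxplus u w : smooth_series := @Sser (fun m => lie_bch series_bracket (letters u w) m m)
  (fun m => smooth_terms _ m).

Lemma eqf_series_boxplus M u w : series_order 1 u -> series_order 1 w ->
  eqs M (series_boxplus u w) (lie_bch series_bracket (letters u w) M).
Proof.
move=> u1 w1; apply/eqfP => m mM; apply: fn_ext => A phi; rewrite /= !terms_sum.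
rewrite [LHS](big_ord_widen M.+1
  (fun n => ((n%:R)^-1 *: dynkin series_bracket (letters u w) n (bch R)) m A phi)) // big_mkcond.
apply: eq_bigr => k _; case: ifP => // /negbT; rewrite -leqNgt => mk.
rewrite termsZE (_ : terms _ m = fzero) ?mulr0 //.
by apply: (fil_dynkin series_filtration series_order0) => // -[].
Qed.

Lemma series_order_boxplus u w : series_order 1 u -> series_order 1 w -> series_order 1 (series_boxplus u w).
Proof.
move=> u1 w1 [] // _; apply: fn_ext => A phi.
by rewrite /= terms_sum big_ord1 termsZE mulr0.
Qed.

(** The Baker-Campbell-Hausdorff theorem for formal series, obtained from [lie_exp_bch] at every
    level [M]. *)
Lemma series_exp_boxplus u w (G : smooth_series) : series_order 1 u -> series_order 1 w ->
  series_exp (series_boxplus u w) G = series_exp u (series_exp w G).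
Proof.
move=> u1 w1; apply: smooth_series_eqf => M.
have tr := eqf_trans series_filtration; have rf := eqf_refl series_filtration.
have cg := eqf_lie_exp series_bracket_lie series_filtration series_order0.
refine (tr _ _ _ _ (eqf_series_exp _ (series_order_boxplus u1 w1)) _).
refine (tr _ _ _ _ (cg _ _ _ _ _ (eqf_series_boxplus u1 w1) (rf _ _)) _).
refine (tr _ _ _ _ (lie_exp_bch series_bracket_lie series_filtration series_order0 _ M G) _); first by case.
apply: (eqf_sym series_filtration).
refine (tr _ _ _ _ (eqf_series_exp _ u1) _); apply: cg; first exact: rf.
exact: eqf_series_exp.
Qed.

Fixpoint series_nested_bracket u w (s : word) : smooth_series :=
  match s with
  | [::] => 0
  | [:: b] => letters u w b
  | b :: s' => series_bracket (letters u w b) (series_nested_bracket u w s')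
  end.

Lemma nested_bracketE u w (s : word) : nested_bracket u w s = terms (series_nested_bracket u w s).
Proof.
elim: s => [|b [|c s] IH] //; first by case: b.
rewrite -[LHS]/(spoisson _ (nested_bracket u w (c :: s))) IH.
by case: b.
Qed.

Lemma wordsS n :
  words n.+1 = [seq true :: s | s <- words n] ++ [seq false :: s | s <- words n].
Proof. by []. Qed.

Lemma words_neq_nil n (s : word) : s \in words n.+1 -> s != [::].
Proof. by rewrite wordsS mem_cat => /orP[] /mapP[s' _ ->]. Qed.

(** Links the recursion on the first letter with the explicit sum over words in [boxplus]; after
    removal of a letter the words are still nonempty, so the nested bracket unfolds. *)
Lemma dynkin_words u w n (p : ncs R) : (0 < n)%N ->
  dynkin series_bracket (letters u w) n p = \sum_(s <- words n) p s *: series_nested_bracket u w s.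
Proof.
elim: n p => [|[|n] IH] p // _; first by rewrite /= !big_cons big_nil addr0.
rewrite dynkinSS !IH // [in RHS]wordsS [RHS]big_cat [in RHS]big_map [X in _ = _ + X]big_map.
rewrite !(lie_sumr series_bracket_lie).
by congr (_ + _); apply: eq_big_seq => -[|b s] /words_neq_nil // _;
  rewrite (lieZr series_bracket_lie).
Qed.

Lemma boxplusE u w : boxplus u w = terms (series_boxplus u w).
Proof.
apply/funext => m; apply: fn_ext => A phi.
rewrite /boxplus sum_n_m1E -[RHS]/(lie_bch series_bracket (letters u w) m m A phi) terms_sum [RHS]big_ord_recl termsZE mulr0 add0r.
apply: eq_bigr => n _; rewrite lift0 dynkin_words // termsZE terms_sum INRE.
rewrite bch_coeffE mulr_sumr.
elim: (words _) => [|s ss IH]; first by rewrite big_nil.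
by rewrite big_cons -IH termsZE -nested_bracketE mulrA [_^-1 * _]mulrC.
Qed.

Definition series_action H (smooth_H : smooth H) u : smooth_series := @Sser (exp_action_series H u)
  (fun m => smooth_exp_action _ _ smooth_H (smooth_terms u m)).

(** * The shift as an automorphism of series *)

Section Action.
Variables (H : fn) (smooth_H : smooth H) (action_H : action_only H).
Local Notation act := (series_action smooth_H).

Lemma series_action_bracket u v : act (series_bracket u v) = series_bracket (act u) (act v).
Proof.
apply: smooth_seriesP => m A phi; rewrite series_bracketE /= /exp_action_series /exp_action.
rewrite -[spoisson _ _]/(terms (series_bracket u v)) series_bracketE; apply: eq_bigr => i _.
by rewrite -exp_action_poisson //; apply: smooth_terms.
Qed.

(** An automorphism of the bracket conjugates each iterated bracket with [u] into one with the image
    of [u]. *)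
Lemma series_action_exp u (G : smooth_series) : act (series_exp u G) = series_exp (act u) (act G).
Proof.
apply: smooth_seriesP => m A phi; rewrite /= /exp_action_series /exp_action !terms_sum.
apply: eq_bigr => k _; rewrite !termsZE; congr (_ * _).
have <- : act (iter k (series_bracket u) G) = iter k (series_bracket (act u)) (act G).
  by elim: (k : nat) => //= n <-; rewrite series_action_bracket.
by [].
Qed.

End Action.

Definition series_monomial k U (smooth_U : smooth U) : smooth_series :=
  @Sser (monomial k U) (fun m =>
    if Nat.eqb m k as b return smooth (if b then U else fzero) then smooth_U
    else smooth_const 0).

Lemma bch_letter b : bch R [:: b] = 1.
Proof.
rewrite /= /log_trunc ncs_coef_sum big_ord1 ncs_coefZ !expr1 divr1 mul1r.
rewrite ncs_coefB ncs_coefM_cons ncs_coefM_nil ncs_coef1 subr0.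
by case: b; rewrite /= !invr1 !mulr1 ?mulr0 ?mul0r ?addr0 ?add0r.
Qed.

(** Only words of length one enter, each with coefficient 1; this is what shows that the first-order
    part of the control term cancels. *)
Lemma series_boxplus1 u w A phi : series_boxplus u w 1 A phi = u 1%N A phi + w 1%N A phi.
Proof.
rewrite -[LHS]/(lie_bch series_bracket (letters u w) 1 1%N A phi) terms_sum big_ord_recl big_ord1.
rewrite !termsZE /= -!/(bch R [:: _]) mulr0 add0r invr1 mul1r.
rewrite -[LHS]/(bch R [:: true] * _ + bch R [:: false] * _).
by rewrite !bch_letter !mul1r.
Qed.

Lemma series_order_monomial U (sU : smooth U) : series_order 1 (series_monomial 1 sU).
Proof. by case. Qed.

Lemma phase_series_monomial k U : phase_function U -> phase_series (monomial k U).
Proof.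
by move=> pU m; rewrite /monomial; case: Nat.eqb => //; apply: phase_function_zero.
Qed.

Theorem proposition1 (H : fn) (Gamma : fn -> fn) (V : fn)
  (H_phase : phase_function H)
  (H_action : action_only H)
  (Gamma_linear : linear_on_phase_functions Gamma)
  (Gamma_pseudo : pseudo_inverse H Gamma)
  (V_phase : phase_function V) :
  let eV := monomial 1 V in
  let eGammaV := monomial 1 (Gamma V) in
  let eNV := monomial 1 (calN H Gamma V) in
  let eRV := monomial 1 (calR H Gamma V) in
  exists f : series,
    phase_series f /\
    of_order 2 f /\
    conjugate_via eGammaV
      (fun G => exp_action_series H (exp_series eV (exp_series f G)))
      (fun G => exp_action_series H (exp_series eRV G)) /\
    f = sopp eV ⊞ ssub eNV eGammaV ⊞ eRV ⊞ eGammaV /\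
    (forall G : series, phase_series G ->
       exp_series eGammaV
         (exp_action_series H
           (exp_series eV
             (exp_series f
               (exp_series (sopp eGammaV) G)))) =
       exp_action_series H (exp_series eRV G)).
Proof.
move=> eV eGammaV eNV eRV.
have sH : smooth H by case: H_phase.
have pG : phase_function (Gamma V) by case: Gamma_linear => pG _; apply: pG.
have pN : phase_function (calN H Gamma V).
  apply: phase_function_sub => //; apply: phase_function_exp_action => //.
    by move=> A phi psi; rewrite /fopp (H_action _ phi psi).
  exact: phase_function_opp.
have pR : phase_function (calR H Gamma V) by apply: phase_function_sub.
pose v := series_monomial 1 (proj1 V_phase); pose g := series_monomial 1 (proj1 pG).
pose n := series_monomial 1 (proj1 pN); pose r := series_monomial 1 (proj1 pR).
pose F := series_boxplus (series_boxplus (series_boxplus (- v) (n - g)) r) g.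
have v1 : series_order 1 v by apply: series_order_monomial.
have g1 : series_order 1 g by apply: series_order_monomial.
have r1 : series_order 1 r by apply: series_order_monomial.
have Nv1 : series_order 1 (- v) by apply: (filN series_filtration).
have ng1 : series_order 1 (n - g).
  apply: (filD series_filtration); first exact: series_order_monomial.
  exact: (filN series_filtration).
have s1 : series_order 1 (series_boxplus (- v) (n - g)) by apply: series_order_boxplus.
have s2 : series_order 1 (series_boxplus (series_boxplus (- v) (n - g)) r) by apply: series_order_boxplus.
(* By the definition of [calH], [calN V - Gamma V] is minus the backward shift of [Gamma V], and the
   forward shift undoes it. *)
have actn : series_action sH (n - g) = - g.
  apply: smooth_seriesP => m A phi.
  rewrite /= /exp_action_series /monomial /sadd /sopp /exp_action /fadd /fopp.
  case: Nat.eqb; last by rewrite /fzero RplusE RoppE oppr0 addr0.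
  have := congr1 (fun U : fn => U A phi) (exp_action_fopp_l H (Gamma V) H_action).
  rewrite /calN /calH /exp_action /fsub /fopp => E.
  by rewrite -[in RHS]E RplusE RminusE !RoppE addrAC subrr add0r.
have key (G : smooth_series) :
  series_exp g (series_action sH (series_exp v (series_exp F (series_exp (- g) G)))) = series_action sH (series_exp r G).
  (* Splitting [e^F] cancels [e^v e^{-v}] at its left end and [e^g e^{-g}] at its right end; then
     the shift passes [e^{n - g}], turning it into [e^{-g}], which meets the leading [e^g]. *)
  rewrite !series_exp_boxplus // !series_expNK // series_action_exp // actn series_expNK //.
have Ef : terms F = sopp eV ⊞ ssub eNV eGammaV ⊞ eRV ⊞ eGammaV.
  by rewrite -!boxplusE.
(* Only smoothness is asked of [G], so that the identity also covers the angle coordinate. *)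
have main (G : series) : (forall m, smooth (G m)) ->
    exp_series eGammaV (exp_action_series H (exp_series eV
      (exp_series F (exp_series (sopp eGammaV) G))))
  = exp_action_series H (exp_series eRV G).
  move=> sG; have := congr1 terms (key (Sser sG)).
  rewrite -!exp_seriesE -[terms (series_action _ _)]/(exp_action_series H (terms _)).
  rewrite -!exp_seriesE -[terms (series_action _ _)]/(exp_action_series H (terms _)).
  by rewrite -!exp_seriesE.
exists (terms F); split; [|split; [|split; [|split]]].
- rewrite Ef; do !apply: phase_series_boxplus.
  + by move=> m; apply: phase_function_opp; apply: phase_series_monomial.
  + by move=> m; apply: phase_function_sub; apply: phase_series_monomial.
  + exact: phase_series_monomial.
  + exact: phase_series_monomial.
- move=> m /ssrnat.ltP; case: m => [|[|m]] // _; first by apply: (series_order_boxplus s2 g1).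
  apply: fn_ext => A phi; rewrite !series_boxplus1.
  (* The first-order part is [-V + (N V - Gamma V) + R V + Gamma V], with [R V = V - N V]. *)
  have cancel (a b c : R) : - a + (b - c) + (a - b) + c = 0 by ring.
  exact: cancel.
- split; [split|split].
  + exact: phase_series_monomial.
  + by move=> m /ssrnat.ltP; case: m.
  + by move=> G pGs; apply: main => m; case: (pGs m).
  (* The terms of the two coordinate series are a coordinate in degree 0 and zero elsewhere, all
     smooth. *)
  + by congr pair; apply: main => m; rewrite /monomial; case: Nat.eqb;
      rewrite ?[smooth fzero]/(smooth (fconst 0));
      first [exact: smooth_const|exact: smooth_coord_A|exact: smooth_coord_phi].
- exact: Ef.
- by move=> G pGs; apply: main => m; case: (pGs m).
Qed.
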